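(* Let $f(z)=z+a_2z^2+a_3z^3+\cdots$ belong to the class $\mathcal{S}^{\star}(q)$, where $q(z)=\sqrt{1+z^2}+z$. Then $$|H_2(2)|\leq\frac14,$$ and this estimate is sharp: the constant $\frac14$ is the best possible bound valid for all $f\in\mathcal{S}^{\star}(q)$.
   Context: Let $\mathbb{D}=\{z\in\mathbb{C}:|z|<1\}$ and let $\mathcal{A}$ be the family of all functions $f$ analytic in $\mathbb{D}$ with $f(0)=0$ and $f'(0)=1$, so that $f(z)=z+a_2z^2+a_3z^3+\cdots$ in $\mathbb{D}$. For $f\in\mathcal{A}$ the second Hankel determinant is $H_2(2)=a_2a_4-a_3^2$. Let $q(z)=\sqrt{1+z^2}+z$ for $z\in\mathbb{D}$, with the principal branch of the square root (so $q(0)=1$). The class $\mathcal{S}^{\star}(q)$ consists of all $f\in\mathcal{A}$ such that $\frac{zf'(z)}{f(z)}\prec q(z)$, where $\prec$ denotes subordination, i.e. there is a function $\omega$ analytic in $\mathbb{D}$ with $\omega(0)=0$ and $|\omega(z)|<1$ for $z\in\mathbb{D}$ such that $\frac{zf'(z)}{f(z)}=\sqrt{1+\omega^2(z)}+\omega(z)$ for all $z\in\mathbb{D}$ (here the quotient $zf'(z)/f(z)$ is understood to be analytic in $\mathbb{D}$, i.e. $f(z)\neq0$ for $z\in\mathbb{D}\setminus\{0\}$, with value $1$ at $z=0$). *)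

(* Defs.v *)
From Stdlib Require Import Reals.
From Coquelicot Require Import Coquelicot.

Local Open Scope C_scope.

Definition unit_disk (z : C) : Prop := (Cmod z < 1)%R.

(* f (z) = sum_n c_n (z - z0)^n on some disk centred at z0; the sequence c is
   then unique, being the sequence of Taylor coefficients of f at z0. *)
Definition has_expansion (f : C -> C) (z0 : C) (c : nat -> C) : Prop :=
  exists r : R, (0 < r)%R /\
    forall z : C, (Cmod (z - z0) < r)%R ->
      @is_pseries C_AbsRing C_NormedModule c (z - z0) (f z).

(* Values of f outside the unit disk are irrelevant. *)
Definition analytic_in_disk (f : C -> C) : Prop :=
  forall z0 : C, unit_disk z0 -> exists c : nat -> C, has_expansion f z0 c.

Definition class_A (f : C -> C) : Prop :=
  analytic_in_disk f /\ f 0 = 0 /\ C_derive f 0 = 1.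

(* Principal branch: the square root of z with argument in (-PI/2, PI/2],
   written through its real and imaginary parts. *)
Definition principal_sqrt (z : C) : C :=
  (sqrt ((Cmod z + Re z) / 2),
   ((if Rle_dec 0 (Im z) then 1 else -1) * sqrt ((Cmod z - Re z) / 2)))%R.

Definition q (z : C) : C := principal_sqrt (1 + z ^ 2) + z.

Definition subordinate (g h : C -> C) : Prop :=
  exists omega : C -> C,
    analytic_in_disk omega /\
    omega 0 = 0 /\
    (forall z : C, unit_disk z -> unit_disk (omega z)) /\
    (forall z : C, unit_disk z -> g z = h (omega z)).

(* z f'(z) / f(z), with its removable singularity at 0 filled in by 1. *)
Definition zf'_over_f (f : C -> C) (z : C) : C :=
  if Ceq_dec z 0 then 1 else z * C_derive f z / f z.

(* Division in C is total, so the nonvanishing of f is required explicitly. *)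
Definition class_S_star (h f : C -> C) : Prop :=
  class_A f /\
  (forall z : C, unit_disk z -> z <> 0 -> f z <> 0) /\
  subordinate (zf'_over_f f) h.

Definition hankel_2_2 (a : nat -> C) : C := a 2%nat * a 4%nat - a 3%nat ^ 2.

(* Main.v *)
Require Import Defs.
From Stdlib Require Import Reals.
From Coquelicot Require Import Coquelicot.
From Stdlib Require Import Arith Lra Lia Classical ClassicalEpsilon List.
Local Open Scope C_scope.

(** Let [w] be the Schwarz function of [f], with coefficients [c1], [c2], [c3].
    As [q w = 1 + w + w ^ 2 / 2 + O (w ^ 4)], comparing coefficients in
    [z * f' = f * q w] gives [48 * H_2(2) = hankel48 c1 c2 c3], where
    [hankel48 c1 c2 c3 = 16 c1 c3 + 4 c1^2 c2 - 12 c2^2 - 7 c1^4].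

    Two steps of the Schur algorithm ([schur_step_coefs], [schwarz_pick]), applied
    after scaling [w] by a factor [< 1], write [c2] and [c3] in terms of [g = c1]
    and of parameters [b], [d] with [|b| <= 1]
    and [|d| <= 1 - |b| ^ 2].  With [c = |g|] and [t = |b|] the triangle
    inequality then yields
      [|hankel48| <= (1 - c^2) (16 c (1 - t^2) + 16 c^2 t^2 + 4 c^2 t
                     + 12 (1 - c^2) t^2) + 7 c^4
                  <= (1 - c^2) (12 + 8 c^2) + 7 c^4 = 12 - 4 c^2 - c^4 <= 12],
    the second step because [12 + 4 c^2 - 16 c = 4 (1 - c) (3 - c) >= 0]
    ([hankel48_schur_parameters]).  The Schur algorithm rests on Schwarz's lemma,
    hence on the maximum principle.  Analyticity being given by local power
    series only, the latter is proved without integrals: at an interior maximum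
    of [|g| ^ 2 + eps |z| ^ 2] the averages over the four points [z + s],
    [z - s], [z + i s], [z - i s] would be too large ([no_interior_max]).
    Functions are handled through their Taylor jets ([jet], [smooth]), which are
    stable under products, quotients and removal of singularities.

    Equality forces [c1 = 0] and [|c2| = 1], so the extremal function belongs to
    [w z = z ^ 2].  It is [f z = z * U z] with [U' = P * U], [U 0 = 1] and
    [P z = (q (z ^ 2) - 1) / z].  The coefficients of [P] are bounded by [1]
    ([sqrt_coefs]), which makes those of [U] bounded by [1] as well
    ([linear_ode]); [U] has no zero because the solution of [V' = - P * V] is its
    reciprocal ([linear_ode_nonzero]).  Here [a_2 = 0] and [a_3 = 1 / 2]. *)

(** * Complex series *)

Fixpoint Csum (u : nat -> C) (n : nat) : C :=
  match n with O => u O | S m => Csum u m + u (S m) end.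

Definition Cser (u : nat -> C) (l : C) : Prop :=
  forall eps : R, (0 < eps)%R ->
    exists N : nat, forall n, (N <= n)%nat -> (Cmod (Csum u n - l) < eps)%R.

Lemma Csum_sum_n u n : Csum u n = @sum_n C_AbelianMonoid u n.
Proof.
  induction n as [|n IH]; simpl.
  - now rewrite sum_O.
  - rewrite sum_Sn, IH; reflexivity.
Qed.

Lemma Csum_ext u v n : (forall k, (k <= n)%nat -> u k = v k) -> Csum u n = Csum v n.
Proof.
  induction n as [|n IH]; intros H; simpl; [apply H; lia|].
  rewrite IH, H; auto.
Qed.

Lemma Csum_plus u v n : Csum (fun k => u k + v k) n = Csum u n + Csum v n.
Proof. induction n as [|n IH]; simpl; [ring|rewrite IH; ring]. Qed.

Lemma Csum_scal c u n : Csum (fun k => c * u k) n = c * Csum u n.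
Proof. induction n as [|n IH]; simpl; [ring|rewrite IH; ring]. Qed.

Lemma Csum_Cmod u v n : (forall k, (k <= n)%nat -> (Cmod (u k) <= v k)%R) ->
  (Cmod (Csum u n) <= sum_f_R0 v n)%R.
Proof.
  induction n as [|n IH]; intros H; simpl; [apply H; lia|].
  eapply Rle_trans; [apply Cmod_triangle|].
  apply Rplus_le_compat; [apply IH; auto | apply H; lia].
Qed.

Lemma Csum_shift u n : Csum u (S n) = u O + Csum (fun k => u (S k)) n.
Proof. induction n as [|n IH]; [reflexivity|]. simpl in *. rewrite IH; ring. Qed.

Lemma Cmod_sym (x y : C) : Cmod (x - y) = Cmod (y - x).
Proof. rewrite <- Cmod_opp. f_equal; ring. Qed.

Lemma Cmod_minus_triangle (x y : C) : (Cmod (x - y) <= Cmod x + Cmod y)%R.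
Proof. unfold Cminus. rewrite <- (Cmod_opp y). apply Cmod_triangle. Qed.

Lemma Cmod_minus_ge (x y : C) : (Cmod x - Cmod y <= Cmod (x - y))%R.
Proof.
  assert (H := Cmod_triangle (x - y) y). replace (x - y + y) with x in H by ring. lra.
Qed.

Lemma Cser_spec u l :
  Cser u l <-> @is_series C_AbsRing C_NormedModule u l.
Proof.
  split.
  - intros H. apply (@filterlim_locally _ _ _ _). intros eps.
    destruct (H eps (cond_pos eps)) as [N HN]. exists N. intros n Hn.
    apply C_NormedModule_mixin_compat1.
    generalize (HN n Hn). rewrite Csum_sum_n. auto.
  - intros H eps Heps.
    assert (H2 : (0 < sqrt 2)%R) by (apply sqrt_lt_R0; lra).
    assert (Hp : (0 < eps / sqrt 2)%R) by (apply Rdiv_lt_0_compat; lra).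
    pose proof (proj1 (@filterlim_locally _ _ _ _ _ _) H (mkposreal _ Hp)) as [N HN].
    exists N. intros n Hn. specialize (HN n Hn).
    apply C_NormedModule_mixin_compat2 in HN. simpl in HN.
    rewrite Csum_sum_n. replace eps with (sqrt 2 * (eps / sqrt 2))%R by (field; lra).
    exact HN.
Qed.

Lemma Cser_unique u l l' : Cser u l -> Cser u l' -> l = l'.
Proof.
  intros H H'. assert (E : Cmod (l - l') = 0).
  { apply Rle_antisym; [|apply Cmod_ge_0]. apply le_epsilon. intros eps Heps.
    destruct (H (eps/2)%R) as [N HN]; [lra|].
    destruct (H' (eps/2)%R) as [N' HN']; [lra|].
    specialize (HN (N+N')%nat ltac:(lia)). specialize (HN' (N+N')%nat ltac:(lia)).
    replace (l - l') with ((Csum u (N+N') - l') - (Csum u (N+N') - l)) by ring.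
    pose proof (Cmod_minus_triangle (Csum u (N+N') - l') (Csum u (N+N') - l)). lra. }
  apply Cmod_eq_0 in E. replace l with (l - l' + l') by ring. rewrite E. ring.
Qed.

Lemma Cser_ext u v l : (forall n, u n = v n) -> Cser u l -> Cser v l.
Proof.
  intros E H eps He. destruct (H eps He) as [N HN]. exists N. intros n Hn.
  rewrite <- (Csum_ext u v n); auto.
Qed.

Lemma Cser_plus u v l m : Cser u l -> Cser v m -> Cser (fun n => u n + v n) (l + m).
Proof. rewrite !Cser_spec. apply (@is_series_plus C_AbsRing C_NormedModule). Qed.

Lemma Cser_scal c u l : Cser u l -> Cser (fun n => c * u n) (c * l).
Proof. rewrite !Cser_spec. apply (@is_series_scal C_AbsRing C_NormedModule). Qed.

Lemma Cser_shift u l : Cser u l <-> Cser (fun n => u (S n)) (l - u O).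
Proof.
  rewrite !Cser_spec. split; intros H.
  - apply (@is_series_incr_1 C_AbsRing C_NormedModule).
    match goal with |- is_series _ ?x => replace x with l end; [exact H|].
    change (l = l - u O + u O). ring.
  - apply (@is_series_decr_1 C_AbsRing C_NormedModule). exact H.
Qed.

Lemma Cser_exists u (v : nat -> R) V :
  (forall n, (Cmod (u n) <= v n)%R) -> infinite_sum v V -> exists l, Cser u l.
Proof.
  intros Hu Hv.
  destruct (@ex_series_le C_AbsRing C_CompleteNormedModule u v) as [l Hl].
  - exact Hu.
  - exists V. now apply is_series_Reals.
  - exists l. now apply Cser_spec.
Qed.

Lemma infinite_sum_partial_le v V N :
  (forall n, (0 <= v n)%R) -> infinite_sum v V -> (sum_f_R0 v N <= V)%R.
Proof.
  intros Hv H. apply sum_incr; auto.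
Qed.

Lemma Csum_tail u (v : nat -> R) N m : (forall n, (Cmod (u n) <= v n)%R) ->
  (Cmod (Csum u (N + m) - Csum u N) <= sum_f_R0 v (N + m) - sum_f_R0 v N)%R.
Proof.
  intros H. induction m as [|m IH].
  - rewrite Nat.add_0_r. replace (Csum u N - Csum u N) with (RtoC 0) by ring.
    rewrite Cmod_0. lra.
  - rewrite Nat.add_succ_r. simpl.
    replace (Csum u (N + m) + u (S (N + m)) - Csum u N)
      with (Csum u (N + m) - Csum u N + u (S (N + m))) by ring.
    pose proof (Cmod_triangle (Csum u (N + m) - Csum u N) (u (S (N + m)))).
    specialize (H (S (N + m))). lra.
Qed.

(** The tail of a dominated series is dominated by the tail of the majorant. *)
Lemma Cser_tail u l (v : nat -> R) V N :
  (forall n, (Cmod (u n) <= v n)%R) -> infinite_sum v V -> Cser u l ->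
  (Cmod (l - Csum u N) <= V - sum_f_R0 v N)%R.
Proof.
  intros Hu Hv Hl. apply le_epsilon. intros eps He.
  destruct (Hl eps He) as [M HM]. specialize (HM (N + M)%nat ltac:(lia)).
  pose proof (Csum_tail u v N M Hu).
  assert (Hn : forall n, (0 <= v n)%R)
    by (intros n; apply Rle_trans with (2 := Hu n); apply Cmod_ge_0).
  pose proof (infinite_sum_partial_le v V (N + M) Hn Hv).
  replace (l - Csum u N) with ((Csum u (N + M) - Csum u N) - (Csum u (N + M) - l)) by ring.
  pose proof (Cmod_minus_triangle (Csum u (N + M) - Csum u N) (Csum u (N + M) - l)). lra.
Qed.

Lemma Cser_le u l B : (forall n, (Cmod (Csum u n) <= B)%R) -> Cser u l -> (Cmod l <= B)%R.
Proof.
  intros H Hl. apply le_epsilon. intros eps He. destruct (Hl eps He) as [N HN].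
  specialize (HN N (le_n N)). specialize (H N).
  pose proof (Cmod_minus_ge l (Csum u N)). rewrite Cmod_sym in HN. lra.
Qed.

Lemma Cser_Csum (u : nat -> nat -> C) U N :
  (forall k, Cser (u k) (U k)) -> Cser (fun n => Csum (fun k => u k n) N) (Csum U N).
Proof.
  intros H. induction N as [|N IH]; simpl; [apply H|].
  apply Cser_plus; auto.
Qed.

Lemma Csum_support (u : nat -> C) n m : (forall k, (n < k)%nat -> u k = 0) ->
  (n <= m)%nat -> Csum u m = Csum u n.
Proof.
  intros H L. induction L as [|m L IH]; [reflexivity|]. simpl.
  rewrite IH, H by lia. ring.
Qed.

Lemma sum_f_R0_mono (w : nat -> R) m n : (forall k, (0 <= w k)%R) -> (m <= n)%nat ->
  (sum_f_R0 w m <= sum_f_R0 w n)%R.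
Proof.
  intros Hw L. induction L as [|n L IH]; [lra|]. simpl. specialize (Hw (S n)). lra.
Qed.

Lemma sum_support (w : nat -> R) n m : (forall k, (0 <= w k)%R) ->
  (forall k, (n < k)%nat -> w k = 0%R) -> (sum_f_R0 w m <= sum_f_R0 w n)%R.
Proof.
  intros Hp H0. destruct (le_lt_dec m n) as [L|L].
  - now apply sum_f_R0_mono.
  - apply Nat.lt_le_incl in L. induction L as [|m L IH]; [lra|]. simpl.
    rewrite (H0 (S m)) by lia. lra.
Qed.

(** Rows of a lower triangular array may be summed first: the first [N + 1] row
    sums and the first [N + 1] column sums only differ by entries lying in
    columns beyond [N], which the tail of [v] controls. *)
Lemma Cser_triangular (u : nat -> nat -> C) (U : nat -> C) (v : nat -> R) V l :
  (forall k n, (n < k)%nat -> u k n = 0) ->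
  (forall k, Cser (u k) (U k)) ->
  (forall n, (sum_f_R0 (fun k => Cmod (u k n)) n <= v n)%R) ->
  infinite_sum v V ->
  Cser (fun n => Csum (fun k => u k n) n) l -> Cser U l.
Proof.
  intros H0 HU Hv HV Hl eps He.
  destruct (Hl (eps/2)%R) as [N HN]; [lra|].
  destruct (HV (eps/2)%R) as [N' HN']; [lra|].
  exists (N + N')%nat. intros n Hn.
  specialize (HN n ltac:(lia)). specialize (HN' n ltac:(lia)).
  unfold Rdist in HN'. apply Rabs_def2 in HN'.
  assert (T : (Cmod (Csum U n - Csum (fun m => Csum (fun k => u k m) n) n)
               <= V - sum_f_R0 v n)%R).
  { apply Cser_tail; auto.
    - intros m. eapply Rle_trans; [apply (Csum_Cmod _ (fun k => Cmod (u k m))); intros; lra|].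
      eapply Rle_trans; [|apply Hv]. apply sum_support.
      + intros; apply Cmod_ge_0.
      + intros k Hk. rewrite H0 by auto. apply Cmod_0.
    - apply Cser_Csum; auto. }
  rewrite (Csum_ext (fun m => Csum (fun k => u k m) n) (fun m => Csum (fun k => u k m) m)) in T.
  2:{ intros m Hm. apply (Csum_support (fun k => u k m)); auto. }
  set (X := Csum (fun m => Csum (fun k => u k m) m) n) in *.
  replace (Csum U n - l) with ((Csum U n - X) + (X - l)) by ring.
  pose proof (Cmod_triangle (Csum U n - X) (X - l)). lra.
Qed.

Definition conv (a b : nat -> C) (n : nat) : C := Csum (fun k => a k * b (n - k)%nat) n.

(** The Cauchy product, as an instance of summation by rows: row [k] is [a k]
    times the series of [b], and the columns are the terms of the product. *)
Lemma Cser_mult a b la lb (va vb : nat -> R) A B :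
  Cser a la -> Cser b lb ->
  (forall n, (Cmod (a n) <= va n)%R) -> (forall n, (Cmod (b n) <= vb n)%R) ->
  infinite_sum va A -> infinite_sum vb B -> Cser (conv a b) (la * lb).
Proof.
  intros Ha Hb Hva Hvb HA HB.
  assert (Pa : forall n, (0 <= va n)%R)
    by (intros n; eapply Rle_trans; [apply Cmod_ge_0|apply Hva]).
  assert (Pb : forall n, (0 <= vb n)%R)
    by (intros n; eapply Rle_trans; [apply Cmod_ge_0|apply Hvb]).
  set (v := fun n => sum_f_R0 (fun k => (va k * vb (n - k)%nat)%R) n).
  assert (HV : infinite_sum v (A * B)).
  { apply is_series_Reals. apply is_series_mult_pos; auto; now apply is_series_Reals. }
  assert (Hc : forall n, (Cmod (conv a b n) <= v n)%R).
  { intros n. apply Csum_Cmod. intros k _. rewrite Cmod_mult.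
    apply Rmult_le_compat; auto using Cmod_ge_0. }
  destruct (Cser_exists _ v _ Hc HV) as [l Hl].
  assert (Hab : Cser (fun k => lb * a k) l).
  { apply (Cser_triangular
      (fun k n => if le_lt_dec k n then a k * b (n - k)%nat else 0) _ v (A * B)).
    - intros k n L. destruct (le_lt_dec k n); [lia|reflexivity].
    - intros k. replace (lb * a k) with (a k * lb) by ring.
      generalize (a k); intros c. induction k as [|k IH].
      + apply (Cser_ext (fun n => c * b n)); [|now apply Cser_scal].
        intros n. destruct (le_lt_dec 0 n); [|lia]. now rewrite Nat.sub_0_r.
      + apply Cser_shift. destruct (le_lt_dec (S k) 0); [lia|].
        replace (c * lb - 0) with (c * lb) by ring.
        apply (Cser_ext _ _ _) with (2 := IH). intros n.
        destruct (le_lt_dec k n), (le_lt_dec (S k) (S n)); try lia; reflexivity.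
    - intros n. apply sum_Rle. intros k L. destruct (le_lt_dec k n); [|lia].
      rewrite Cmod_mult. apply Rmult_le_compat; auto using Cmod_ge_0.
    - exact HV.
    - apply (Cser_ext _ _ _) with (2 := Hl). intros n. apply Csum_ext. intros k L.
      destruct (le_lt_dec k n); [reflexivity|lia]. }
  replace (la * lb) with l; [exact Hl|].
  apply (Cser_unique _ _ _ Hab). replace (la * lb) with (lb * la) by ring.
  now apply Cser_scal.
Qed.

(** * Complex power series *)

Definition Cpser (a : nat -> C) (z l : C) : Prop := Cser (fun n => a n * z ^ n) l.

Lemma is_pseries_Cpser a z l :
  @is_pseries C_AbsRing C_NormedModule a z l <-> Cpser a z l.
Proof.
  assert (P : forall n, @pow_n C_Ring z n = z ^ n).
  { induction n as [|n IH]; [reflexivity|]. simpl. rewrite <- IH. reflexivity. }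
  assert (E : forall n, scal (@pow_n C_Ring z n) (a n : C_NormedModule) = a n * z ^ n).
  { intros n. rewrite P. change (z ^ n * a n = a n * z ^ n). ring. }
  unfold is_pseries, Cpser. rewrite Cser_spec. split.
  - apply is_series_ext. exact E.
  - apply is_series_ext. intros n. symmetry. apply E.
Qed.

Lemma infinite_sum_geom K s : (0 <= s < 1)%R ->
  infinite_sum (fun n => K * s ^ n)%R (K * / (1 - s))%R.
Proof.
  intros H. apply is_series_Reals.
  apply (@is_series_scal_l R_AbsRing R_NormedModule).
  apply is_series_geom. rewrite Rabs_pos_eq; lra.
Qed.

Lemma infinite_sum_linear_geom s : (0 <= s < 1)%R ->
  infinite_sum (fun n => INR (S n) * s ^ n)%R (/ (1 - s) * / (1 - s))%R.
Proof.
  intros H. apply is_series_Reals.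
  assert (G : is_series (fun n => s ^ n)%R (/ (1 - s))%R)
    by (apply is_series_geom; rewrite Rabs_pos_eq; lra).
  assert (P : forall n, (0 <= s ^ n)%R) by (intros; apply pow_le; lra).
  apply is_series_ext with (2 := is_series_mult_pos _ _ _ _ G G P P).
  intros n. match goal with |- ?x = ?y => change (@eq R x y) end.
  rewrite (sum_eq _ (fun _ => s ^ n)%R).
  - rewrite sum_cte. ring.
  - intros k L. rewrite <- pow_add. f_equal. lia.
Qed.

Lemma Cser_bounded u l : Cser u l -> exists K, forall n, (Cmod (u n) <= K)%R.
Proof.
  intros H. destruct (@filterlim_bounded C_AbsRing C_NormedModule (Csum u)) as [M HM].
  - exists l. apply Cser_spec in H. apply filterlim_ext with (2 := H).
    intros n. symmetry. apply Csum_sum_n.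
  - assert (HM' : forall n, (Cmod (Csum u n) <= M)%R) by exact HM.
    exists (M + M)%R. intros [|n].
    + specialize (HM' O). simpl in HM'. pose proof (Cmod_ge_0 (u O)). lra.
    + replace (u (S n)) with (Csum u (S n) - Csum u n) by (simpl; ring).
      pose proof (Cmod_minus_triangle (Csum u (S n)) (Csum u n)).
      pose proof (HM' n). pose proof (HM' (S n)). lra.
Qed.

(** All that the estimates below use of convergence: such a bound holds as soon
    as the terms of the series are bounded at one point of modulus [rho], and it
    gives domination by a geometric series inside that radius. *)
Definition coef_bound (a : nat -> C) (rho K : R) : Prop :=
  (0 < rho)%R /\ forall n, (Cmod (a n) * rho ^ n <= K)%R.

Lemma coef_bound_pos a rho K : coef_bound a rho K -> (0 <= K)%R.
Proof.
  intros [_ H]. eapply Rle_trans; [|apply (H O)]. simpl. rewrite Rmult_1_r. apply Cmod_ge_0.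
Qed.

Lemma Cpser_coef_bound a (z l : C) : z <> 0 -> Cpser a z l -> exists K, coef_bound a (Cmod z) K.
Proof.
  intros Hz H. destruct (Cser_bounded _ _ H) as [K HK]. exists K. split.
  - apply (proj1 (Cmod_gt_0 z) Hz).
  - intros n. specialize (HK n). rewrite Cmod_mult, Cmod_pow in HK. exact HK.
Qed.

Lemma coef_bound_term a rho K n x : coef_bound a rho K -> (0 <= x)%R ->
  (Cmod (a n) * x ^ n <= K * (x / rho) ^ n)%R.
Proof.
  intros [Hr H] Hx. replace (Cmod (a n) * x ^ n)%R with ((Cmod (a n) * rho ^ n) * (x / rho) ^ n)%R.
  - apply Rmult_le_compat_r; [|apply H]. apply pow_le. apply Rdiv_le_0_compat; lra.
  - unfold Rdiv. rewrite Rpow_mult_distr, pow_inv by lra. field. apply pow_nonzero. lra.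
Qed.

Lemma ratio_lt_1 x rho : (0 <= x < rho)%R -> (0 <= x / rho < 1)%R.
Proof.
  intros H. split; [apply Rdiv_le_0_compat; lra|].
  apply Rmult_lt_reg_r with rho; [lra|]. unfold Rdiv. rewrite Rmult_assoc, Rinv_l; lra.
Qed.

Lemma coef_bound_Cpser_exists a rho K z : coef_bound a rho K -> (Cmod z < rho)%R ->
  exists l, Cpser a z l.
Proof.
  intros H Hz.
  apply (Cser_exists _ (fun n => K * (Cmod z / rho) ^ n)%R (K * / (1 - Cmod z / rho))%R).
  - intros n. rewrite Cmod_mult, Cmod_pow. apply coef_bound_term; auto using Cmod_ge_0.
  - apply infinite_sum_geom, ratio_lt_1. split; auto using Cmod_ge_0.
Qed.

Definition Cseries (u : nat -> C) : C := epsilon (inhabits (RtoC 0)) (Cser u).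

Lemma Cseries_correct u : (exists l, Cser u l) -> Cser u (Cseries u).
Proof. apply epsilon_spec. Qed.

(** The coefficient of [h ^ k] in [(z + h) ^ n], by Pascal's recursion: the
    binomial formula and its absolute version then are inductions on [n]. *)
Fixpoint shift_coef (z : C) (n k : nat) : C :=
  match n with
  | O => match k with O => 1 | S _ => 0 end
  | S m => z * shift_coef z m k + match k with O => 0 | S j => shift_coef z m j end
  end.

Lemma shift_coef_0 z n k : (n < k)%nat -> shift_coef z n k = 0.
Proof.
  revert k. induction n as [|n IH]; intros [|k] L; simpl; try lia; [reflexivity|].
  rewrite !IH by lia. ring.
Qed.

Lemma shift_coef_sum z h n : Csum (fun k => shift_coef z n k * h ^ k) n = (z + h) ^ n.
Proof.
  induction n as [|n IH]; [simpl; ring|].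
  rewrite (Csum_ext _ (fun k => z * (shift_coef z n k * h ^ k)
     + match k with O => 0 | S j => shift_coef z n j * h ^ S j end)).
  2:{ intros [|k] _; simpl; ring. }
  rewrite Csum_plus, Csum_scal.
  rewrite (Csum_support (fun k => shift_coef z n k * h ^ k) n (S n)); [|intros k L|lia].
  2:{ rewrite shift_coef_0 by lia. ring. }
  rewrite Csum_shift.
  rewrite (Csum_ext (fun k => shift_coef z n k * h ^ S k)
     (fun k => h * (shift_coef z n k * h ^ k))) by (intros; simpl; ring).
  rewrite Csum_scal, IH. simpl. ring.
Qed.

Lemma shift_coef_Cmod z n k :
  (Cmod (shift_coef z n k) <= Re (shift_coef (RtoC (Cmod z)) n k))%R.
Proof.
  revert k. induction n as [|n IH]; intros k.
  - destruct k; simpl; [rewrite Cmod_1|rewrite Cmod_0]; lra.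
  - simpl. eapply Rle_trans; [apply Cmod_triangle|]. rewrite Cmod_mult.
    pose proof (IH k). pose proof (Cmod_ge_0 z).
    assert (Cmod z * Cmod (shift_coef z n k)
        <= Cmod z * Re (shift_coef (RtoC (Cmod z)) n k))%R by (apply Rmult_le_compat_l; auto).
    destruct k; simpl; [rewrite Cmod_0|pose proof (IH k); unfold Re in *; simpl]; 
      unfold Re in *; lra.
Qed.

Lemma Re_Csum u n : Re (Csum u n) = sum_f_R0 (fun k => Re (u k)) n.
Proof. induction n as [|n IH]; simpl; [reflexivity|]. now rewrite <- IH. Qed.

Lemma shift_coef_abs_sum z (h : R) n : (0 <= h)%R ->
  (sum_f_R0 (fun k => Cmod (shift_coef z n k) * h ^ k)%R n <= (Cmod z + h) ^ n)%R.
Proof.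
  intros Hh. replace ((Cmod z + h) ^ n)%R with (Re ((RtoC (Cmod z) + RtoC h) ^ n)).
  2:{ rewrite <- RtoC_plus, <- RtoC_pow. reflexivity. }
  rewrite <- shift_coef_sum, Re_Csum. apply sum_Rle. intros k _.
  rewrite <- RtoC_pow, Rmult_comm, Cmult_comm.
  replace (Re (RtoC (h ^ k) * shift_coef (RtoC (Cmod z)) n k))
    with (h ^ k * Re (shift_coef (RtoC (Cmod z)) n k))%R by (unfold Re; simpl; ring).
  apply Rmult_le_compat_l; [now apply pow_le|]. apply shift_coef_Cmod.
Qed.

Lemma shift_coef_00 z n : shift_coef z n 0 = z ^ n.
Proof. induction n as [|n IH]; simpl; [reflexivity|]. rewrite IH; ring. Qed.

Lemma shift_coef_1 z n : shift_coef z (S n) 1 = RtoC (INR (S n)) * z ^ n.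
Proof.
  induction n as [|n IH]; [simpl; ring|].
  change (z * shift_coef z (S n) 1 + shift_coef z (S n) 0 = RtoC (INR (S (S n))) * z ^ S n).
  rewrite IH, shift_coef_00, (S_INR (S n)), RtoC_plus. simpl. ring.
Qed.

Lemma term_le_sum (w : nat -> R) k n : (forall j, (0 <= w j)%R) -> (k <= n)%nat ->
  (w k <= sum_f_R0 w n)%R.
Proof.
  intros P L. induction L as [|n L IH].
  - destruct k; simpl; [lra|]. pose proof (cond_pos_sum w k P). lra.
  - simpl. specialize (P (S n)). lra.
Qed.

Definition deriv_coef (a : nat -> C) (n : nat) : C := RtoC (INR (S n)) * a (S n).

(** Expanding [a n * (z0 + h) ^ n] by the binomial formula gives a triangular
    array whose column [n] is bounded by [K * ((|z0| + |h|) / rho) ^ n]; its rows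
    give the expansion at [z0]. *)
Lemma Cpser_recenter a rho K (f : C -> C) z0 :
  coef_bound a rho K -> (forall z, (Cmod z < rho)%R -> Cpser a z (f z)) ->
  (Cmod z0 < rho)%R ->
  exists d, (forall h, (Cmod z0 + Cmod h < rho)%R -> Cpser d h (f (z0 + h)))
            /\ Cpser (deriv_coef a) z0 (d 1%nat).
Proof.
  intros Ha Hf Hz. pose proof (proj1 Ha) as Hr. pose proof (Cmod_ge_0 z0) as Hz0.
  assert (Hd : forall k, exists l, Cser (fun n => a n * shift_coef z0 n k) l).
  { intros k. set (r := ((rho - Cmod z0) / 2)%R). assert (0 < r)%R by (unfold r; lra).
    set (s := ((Cmod z0 + r) / rho)%R).
    assert (Hs : (0 <= s < 1)%R) by (apply ratio_lt_1; unfold r; lra).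
    apply (Cser_exists _ (fun n => (K / r ^ k) * s ^ n)%R (K / r ^ k * / (1 - s))%R);
      [|now apply infinite_sum_geom].
    intros n. assert (Hrk : (0 < r ^ k)%R) by now apply pow_lt.
    apply Rmult_le_reg_r with (1 := Hrk). rewrite Cmod_mult.
    replace (K / r ^ k * s ^ n * r ^ k)%R with (K * s ^ n)%R by (field; lra).
    eapply Rle_trans; [|apply coef_bound_term; [exact Ha|lra]].
    rewrite Rmult_assoc. apply Rmult_le_compat_l; [apply Cmod_ge_0|].
    destruct (le_lt_dec k n) as [L|L].
    - eapply Rle_trans; [|apply shift_coef_abs_sum; lra].
      apply (term_le_sum (fun j => Cmod (shift_coef z0 n j) * r ^ j)%R); auto.
      intros j. apply Rmult_le_pos; [apply Cmod_ge_0|apply pow_le; lra].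
    - rewrite shift_coef_0, Cmod_0, Rmult_0_l by auto. apply pow_le. lra. }
  exists (fun k => Cseries (fun n => a n * shift_coef z0 n k)). split.
  - intros h Hh. pose proof (Cmod_ge_0 h) as Hh0.
    set (s := ((Cmod z0 + Cmod h) / rho)%R).
    assert (Hs : (0 <= s < 1)%R) by (apply ratio_lt_1; lra).
    apply (Cser_triangular (fun k n => a n * shift_coef z0 n k * h ^ k) _
      (fun n => K * s ^ n)%R (K * / (1 - s))%R).
    + intros k n L. rewrite shift_coef_0 by auto. ring.
    + intros k. pose proof (Cser_scal (h ^ k) _ _ (Cseries_correct _ (Hd k))) as H.
      rewrite Cmult_comm. apply (Cser_ext _ _ _) with (2 := H). intros n; simpl; ring.
    + intros n. eapply Rle_trans; [|apply coef_bound_term; [exact Ha|lra]].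
      rewrite (sum_eq _ (fun k => (Cmod (shift_coef z0 n k) * Cmod h ^ k) * Cmod (a n))%R).
      2:{ intros k _. rewrite !Cmod_mult, Cmod_pow. ring. }
      rewrite <- scal_sum. apply Rmult_le_compat_l; [apply Cmod_ge_0|].
      now apply shift_coef_abs_sum.
    + now apply infinite_sum_geom.
    + apply (Cser_ext (fun n => a n * (z0 + h) ^ n)).
      * intros n. rewrite <- shift_coef_sum, <- Csum_scal. apply Csum_ext. intros; ring.
      * apply Hf. eapply Rle_lt_trans; [apply Cmod_triangle|lra].
  - pose proof (Cseries_correct _ (Hd 1%nat)) as H. apply Cser_shift in H.
    replace (Cseries (fun n => a n * shift_coef z0 n 1) - a 0%nat * shift_coef z0 0 1)
      with (Cseries (fun n => a n * shift_coef z0 n 1)) in H by (simpl; ring).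
    apply (Cser_ext _ _ _) with (2 := H). intros n. rewrite shift_coef_1.
    unfold deriv_coef. ring.
Qed.

(** * Taylor jets *)

(** The point [0] itself is left out, so that jets do not see removable
    singularities. *)
Definition near0 (P : C -> Prop) : Prop :=
  exists delta : R, (0 < delta)%R /\
    forall h : C, h <> 0 -> (Cmod h < delta)%R -> P h.

Lemma near0_and P Q : near0 P -> near0 Q -> near0 (fun h => P h /\ Q h).
Proof.
  intros [d [Hd H]] [d' [Hd' H']]. exists (Rmin d d'). split; [now apply Rmin_pos|].
  intros h h0 L. split.
  - apply H; auto. eapply Rlt_le_trans; [exact L|apply Rmin_l].
  - apply H'; auto. eapply Rlt_le_trans; [exact L|apply Rmin_r].
Qed.

Lemma near0_impl (P Q : C -> Prop) : (forall h : C, h <> 0 -> P h -> Q h) -> near0 P -> near0 Q.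
Proof. intros PQ [d [Hd H]]. exists d. split; [exact Hd|]. intros h h0 L. now apply PQ, H. Qed.

Lemma near0_all (P : C -> Prop) : (forall h : C, h <> 0 -> P h) -> near0 P.
Proof. intros H. exists 1%R. split; [lra|auto]. Qed.

Lemma near0_lt (e : R) : (0 < e)%R -> near0 (fun h => (Cmod h < e)%R).
Proof. intros H. exists e. auto. Qed.

Lemma near0_ex P : near0 P -> exists h : C, h <> 0 /\ P h.
Proof.
  intros [d [Hd H]]. exists (RtoC (d / 2)).
  assert (E : RtoC (d / 2) <> 0).
  { intros E. apply RtoC_inj in E. lra. }
  split; auto. apply H; auto. rewrite Cmod_R, Rabs_pos_eq; lra.
Qed.

(** The expansion [g h = a 0 + a 1 * h + ... + a (N - 1) * h ^ (N - 1) + O (h ^ N)]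
    as [h] tends to [0], nested as in Horner's scheme so that the algebra of jets goes by
    induction on the order [N]. *)
Fixpoint jet (N : nat) (a : nat -> C) (g : C -> C) : Prop :=
  match N with
  | O => exists K : R, near0 (fun h => (Cmod (g h) <= K)%R)
  | S M => exists g1, near0 (fun h => g h = a O + h * g1 h) /\ jet M (fun n => a (S n)) g1
  end.

Lemma jet_ext N a b g g' : (forall n, (n < N)%nat -> a n = b n) ->
  near0 (fun h => g h = g' h) -> jet N a g -> jet N b g'.
Proof.
  destruct N as [|N]; intros Hab Hg H.
  - destruct H as [K HK]. exists K.
    apply (near0_impl _ _) with (2 := near0_and _ _ Hg HK). intros h _ [E L]. now rewrite <- E.
  - revert a b g g' Hab Hg H. induction N as [|N IH]; intros a b g g' Hab Hg [g1 [H1 H2]];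
      exists g1; (split; [apply (near0_impl _ _) with (2 := near0_and _ _ Hg H1);
        intros h _ [E L]; rewrite <- E, L, Hab by lia; reflexivity|]).
    + exact H2.
    + apply (IH (fun n => a (S n)) (fun n => b (S n)) g1 g1); auto.
      * intros n L. apply Hab. lia.
      * now apply near0_all.
Qed.

Lemma jet_bounded N a g : jet N a g -> exists K, (0 <= K)%R /\ near0 (fun h => (Cmod (g h) <= K)%R).
Proof.
  revert a g. induction N as [|N IH]; intros a g H.
  - destruct H as [K HK]. exists (Rabs K). split; [apply Rabs_pos|].
    apply (near0_impl _ _) with (2 := HK). intros h _ L. pose proof (Rle_abs K). lra.
  - destruct H as [g1 [H1 H2]]. destruct (IH _ _ H2) as [K [HK0 HK]].
    exists (Cmod (a O) + K)%R. split; [pose proof (Cmod_ge_0 (a O)); lra|].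
    apply (near0_impl _ _) with
      (2 := near0_and _ _ H1 (near0_and _ _ HK (near0_lt 1 Rlt_0_1))).
    intros h _ [E [L1 L2]]. rewrite E. eapply Rle_trans; [apply Cmod_triangle|].
    rewrite Cmod_mult. pose proof (Cmod_ge_0 h). pose proof (Cmod_ge_0 (g1 h)). nra.
Qed.

Lemma jet_S N a g : jet (S N) a g -> jet N a g.
Proof.
  revert a g. induction N as [|N IH]; intros a g H.
  - destruct (jet_bounded _ _ _ H) as [K [_ HK]]. now exists K.
  - destruct H as [g1 [H1 H2]]. exists g1. split; auto.
Qed.

Lemma jet_le N M a g : (N <= M)%nat -> jet M a g -> jet N a g.
Proof. intros L. induction L as [|M L IH]; auto. intros H. apply IH, jet_S, H. Qed.

Lemma jet_lim N a g : jet (S N) a g ->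
  exists K, (0 <= K)%R /\ near0 (fun h => (Cmod (g h - a O) <= K * Cmod h)%R).
Proof.
  intros [g1 [H1 H2]]. destruct (jet_bounded _ _ _ H2) as [K [HK0 HK]]. exists K. split; auto.
  apply (near0_impl _ _) with (2 := near0_and _ _ H1 HK). intros h _ [E L].
  rewrite E. replace (a O + h * g1 h - a O) with (g1 h * h) by ring. rewrite Cmod_mult.
  apply Rmult_le_compat_r; auto using Cmod_ge_0.
Qed.

Lemma near0_linear_lt (K e : R) : (0 <= K)%R -> (0 < e)%R ->
  near0 (fun h => (K * Cmod h < e)%R).
Proof.
  intros HK He. assert (P : (0 < e / (K + 1))%R) by (apply Rdiv_lt_0_compat; lra).
  apply (near0_impl _ _) with (2 := near0_lt _ P). intros h _ L.
  pose proof (Cmod_ge_0 h).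
  apply Rle_lt_trans with ((K + 1) * Cmod h)%R; [nra|].
  replace e with ((K + 1) * (e / (K + 1)))%R by (field; lra).
  apply Rmult_lt_compat_l; lra.
Qed.

Lemma jet_lim_unique N M a b g : jet (S N) a g -> jet (S M) b g -> a O = b O.
Proof.
  intros Ha Hb. destruct (jet_lim _ _ _ Ha) as [K [HK0 HK]].
  destruct (jet_lim _ _ _ Hb) as [K' [HK0' HK']].
  assert (E : Cmod (a O - b O) = 0%R).
  { apply Rle_antisym; [|apply Cmod_ge_0]. apply le_epsilon. intros e He.
    destruct (near0_ex _ (near0_and _ _ (near0_and _ _ HK HK')
      (near0_linear_lt (K + K') e ltac:(lra) He))) as [h [_ [[L1 L2] L3]]].
    replace (a O - b O) with ((g h - b O) - (g h - a O)) by ring.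
    pose proof (Cmod_minus_triangle (g h - b O) (g h - a O)). lra. }
  apply Cmod_eq_0 in E. replace (a O) with (a O - b O + b O) by ring. rewrite E. ring.
Qed.

(** The leading coefficient is the limit at [0]; removing it and dividing by [h]
    gives the next one. *)
Lemma jet_unique N a b g : jet N a g -> jet N b g -> forall n, (n < N)%nat -> a n = b n.
Proof.
  revert a b g. induction N as [|N IH]; intros a b g Ha Hb n L; [lia|].
  assert (E0 := jet_lim_unique _ _ _ _ _ Ha Hb). destruct n as [|n]; [exact E0|].
  destruct Ha as [g1 [H1 H2]], Hb as [g2 [H3 H4]].
  apply (IH (fun n => a (S n)) (fun n => b (S n)) g1); auto; [|lia].
  apply (jet_ext _ _ _ g2 g1 (fun n _ => eq_refl)) with (2 := H4).
  apply (near0_impl _ _) with (2 := near0_and _ _ H1 H3). intros h h0 [E E'].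
  rewrite E' in E. apply (f_equal (fun x => / h * (x - a O))) in E.
  rewrite <- E0 in E. 
  replace (g2 h) with (/ h * (a O + h * g2 h - a O)) by (field; auto).
  rewrite E. field; auto.
Qed.

Lemma jet_const N c : jet N (fun n => match n with O => c | _ => 0 end) (fun _ => c).
Proof.
  revert c. induction N as [|N IH]; intros c.
  - exists (Cmod c). apply near0_all. intros; lra.
  - exists (fun _ => 0). split; [apply near0_all; intros; ring|].
    apply (jet_ext _ _ _ _ _) with (3 := IH 0); [intros [|n]; auto|apply near0_all; auto].
Qed.

Lemma jet_plus N a b g k : jet N a g -> jet N b k ->
  jet N (fun n => a n + b n) (fun h => g h + k h).
Proof.
  revert a b g k. induction N as [|N IH]; intros a b g k Ha Hb.
  - destruct Ha as [K HK], Hb as [K' HK']. exists (K + K')%R.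
    apply (near0_impl _ _) with (2 := near0_and _ _ HK HK'). intros h _ [L L'].
    pose proof (Cmod_triangle (g h) (k h)). lra.
  - destruct Ha as [g1 [H1 H2]], Hb as [g2 [H3 H4]].
    exists (fun h => g1 h + g2 h). split; [|now apply IH].
    apply (near0_impl _ _) with (2 := near0_and _ _ H1 H3). intros h _ [E E'].
    rewrite E, E'. ring.
Qed.

Lemma jet_scal N c a g : jet N a g -> jet N (fun n => c * a n) (fun h => c * g h).
Proof.
  revert a g. induction N as [|N IH]; intros a g Ha.
  - destruct Ha as [K HK]. exists (Cmod c * K)%R.
    apply (near0_impl _ _) with (2 := HK). intros h _ L. rewrite Cmod_mult.
    apply Rmult_le_compat_l; auto using Cmod_ge_0.
  - destruct Ha as [g1 [H1 H2]]. exists (fun h => c * g1 h). split; [|now apply IH].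
    apply (near0_impl _ _) with (2 := H1). intros h _ E. rewrite E. ring.
Qed.

Lemma conv_S a b n : conv a b (S n) = a O * b (S n) + conv (fun n => a (S n)) b n.
Proof.
  unfold conv. rewrite Csum_shift, Nat.sub_0_r. f_equal.
Qed.

Lemma jet_mult N a b g k : jet N a g -> jet N b k -> jet N (conv a b) (fun h => g h * k h).
Proof.
  revert a b g k. induction N as [|N IH]; intros a b g k Ha Hb.
  - destruct (jet_bounded _ _ _ Ha) as [K [K0 HK]], (jet_bounded _ _ _ Hb) as [K' [K0' HK']].
    exists (K * K')%R.
    apply (near0_impl _ _) with (2 := near0_and _ _ HK HK'). intros h _ [L L'].
    rewrite Cmod_mult. apply Rmult_le_compat; auto using Cmod_ge_0.
  - pose proof (jet_S _ _ _ Hb) as Hb'.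
    destruct Ha as [g1 [H1 H2]], Hb as [k1 [H3 H4]].
    exists (fun h => a O * k1 h + g1 h * k h). split.
    + apply (near0_impl _ _) with (2 := near0_and _ _ H1 H3). intros h _ [E E'].
      rewrite E, E'. unfold conv; simpl. ring.
    + apply (jet_ext _ (fun n => a O * b (S n) + conv (fun n => a (S n)) b n)
                 _ (fun h => a O * k1 h + g1 h * k h)).
      * intros n _. now rewrite conv_S.
      * now apply near0_all.
      * apply (jet_plus _ _ _ (fun h => a O * k1 h) (fun h => g1 h * k h)).
        -- now apply (jet_scal _ _ (fun n => b (S n))).
        -- now apply IH.
Qed.

(** From [g = a 0 + h * g1] one gets [1 / g = 1 / a 0 - h * g1 / (a 0 * g)], and
    the second term only needs the jet of [1 / g] to one order less. *)
Lemma jet_inv N (a : nat -> C) g (m : R) : (0 < m)%R ->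
  near0 (fun h => (m <= Cmod (g h))%R) -> a O <> 0 ->
  jet N a g -> exists b, b O = / a O /\ jet N b (fun h => / g h).
Proof.
  intros Hm Hg Ha. induction N as [|N IH]; intros H.
  - exists (fun _ => / a O). split; auto. exists (/ m)%R.
    apply (near0_impl _ _) with (2 := Hg). intros h _ L.
    rewrite Cmod_inv; [now apply Rinv_le_contravar|].
    intros E. rewrite E, Cmod_0 in L. lra.
  - destruct (IH (jet_S _ _ _ H)) as [b [_ Hb]]. destruct H as [g1 [H1 H2]].
    exists (fun n => match n with O => / a O | S n => - / a O * conv (fun n => a (S n)) b n end).
    split; auto.
    exists (fun h => - / a O * (g1 h * / g h)). split.
    + apply (near0_impl _ _) with (2 := near0_and _ _ H1 Hg). intros h _ [E L].
      assert (g h <> 0) by (intros E'; rewrite E', Cmod_0 in L; lra).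
      replace (h * (- / a O * (g1 h * / g h))) with (/ a O * / g h * - (h * g1 h)) by ring.
      replace (h * g1 h) with (g h - a O) by (rewrite E; ring). field. auto.
    + apply (jet_scal _ _ (conv (fun n => a (S n)) b)). now apply jet_mult.
Qed.

Lemma jet_bigO N K g : near0 (fun h => (Cmod (g h) <= K * Cmod h ^ N)%R) ->
  jet N (fun _ => 0) g.
Proof.
  revert g. induction N as [|N IH]; intros g H.
  - exists K. apply (near0_impl _ _) with (2 := H). intros h _ L. simpl in L. lra.
  - exists (fun h => g h / h). split.
    + apply near0_all. intros h h0. field. auto.
    + apply IH. apply (near0_impl _ _) with (2 := H). intros h h0 L.
      rewrite Cmod_div by auto. pose proof (proj1 (Cmod_gt_0 h) h0) as P.
      apply Rmult_le_reg_r with (1 := P). unfold Rdiv. rewrite Rmult_assoc, Rinv_l by lra.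
      simpl in L. lra.
Qed.

Lemma jet_id N c : jet N (fun n => match n with O => c | S O => 1 | _ => 0 end) (fun h => c + h).
Proof.
  destruct N as [|N].
  - exists (Cmod c + 1)%R. apply (near0_impl _ _) with (2 := near0_lt 1 Rlt_0_1).
    intros h _ L. pose proof (Cmod_triangle c h). lra.
  - exists (fun _ => 1). split; [apply near0_all; intros; ring|].
    apply (jet_ext _ _ _ _ _) with (3 := jet_const N 1); [intros [|n]; auto|apply near0_all; auto].
Qed.

(** * Power series have jets of every order *)

Definition locally_sums (a : nat -> C) (f : C -> C) : Prop :=
  exists r : R, (0 < r)%R /\ forall z : C, (Cmod z < r)%R -> Cpser a z (f z).

Lemma Cpser_0 a l : Cpser a 0 l -> l = a O.
Proof.
  intros H. apply (Cser_unique _ _ _ H). intros e He. exists O. intros n _.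
  replace (Csum (fun n => a n * 0 ^ n) n) with (a O).
  - replace (a O - a O) with (RtoC 0) by ring. now rewrite Cmod_0.
  - induction n as [|n IH]; simpl in *; [ring|]. rewrite <- IH. ring.
Qed.

Lemma Cpser_shift a (z l : C) : z <> 0 -> Cpser a z l ->
  Cpser (fun n => a (S n)) z ((l - a O) / z).
Proof.
  intros Hz H. apply Cser_shift in H.
  pose proof (Cser_scal (/ z) _ _ H) as H'. unfold Cpser.
  replace ((l - a O) / z) with (/ z * (l - a O * z ^ 0)) by (simpl; field; auto).
  apply (Cser_ext _ _ _) with (2 := H'). intros n. simpl. field. auto.
Qed.

Lemma locally_sums_split a f : locally_sums a f ->
  exists f1, locally_sums (fun n => a (S n)) f1 /\ near0 (fun h => f h = a O + h * f1 h).
Proof.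
  intros [r [Hr H]]. exists (fun z => if Ceq_dec z 0 then a 1%nat else (f z - a O) / z).
  split.
  - exists r. split; auto. intros z Hz. destruct (Ceq_dec z 0) as [E|E].
    + rewrite E. intros e He. exists O. intros n _.
      replace (Csum (fun n => a (S n) * 0 ^ n) n) with (a 1%nat).
      * replace (a 1%nat - a 1%nat) with (RtoC 0) by ring. now rewrite Cmod_0.
      * clear. induction n as [|n IH]; simpl in *; [ring|]. rewrite <- IH. ring.
    + apply Cpser_shift; auto.
  - apply near0_all. intros h h0. destruct (Ceq_dec h 0); [tauto|]. field. auto.
Qed.

Lemma locally_sums_coef_bound a f : locally_sums a f -> exists rho K, coef_bound a rho K.
Proof.
  intros [r [Hr H]]. destruct (Cpser_coef_bound a (RtoC (r / 2)) (f (RtoC (r / 2)))) as [K HK].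
  - intros E. apply RtoC_inj in E. lra.
  - apply H. rewrite Cmod_R, Rabs_pos_eq; lra.
  - eauto.
Qed.

Lemma locally_sums_bounded a f : locally_sums a f -> jet 0 a f.
Proof.
  intros H. destruct (locally_sums_coef_bound _ _ H) as [rho [K HK]].
  destruct H as [r [Hr H]]. pose proof (coef_bound_pos _ _ _ HK) as K0. destruct (HK) as [Hrho _].
  exists (K * / (1 - / 2))%R.
  assert (P : (0 < Rmin r (rho / 2))%R) by (apply Rmin_pos; lra).
  apply (near0_impl _ _) with (2 := near0_lt _ P). intros h _ L.
  pose proof (Rmin_l r (rho / 2)). pose proof (Rmin_r r (rho / 2)).
  apply (Cser_le (fun n => a n * h ^ n)); [|apply H; lra].
  intros n. eapply Rle_trans; [apply Csum_Cmod with (v := (fun n => K * (/ 2) ^ n)%R)|].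
  - intros k _. rewrite Cmod_mult, Cmod_pow.
    eapply Rle_trans; [apply coef_bound_term; [exact HK|apply Cmod_ge_0]|].
    apply Rmult_le_compat_l; auto. apply pow_incr. split.
    + apply Rdiv_le_0_compat; [apply Cmod_ge_0|lra].
    + apply Rmult_le_reg_r with (1 := Hrho). unfold Rdiv. rewrite Rmult_assoc, Rinv_l; lra.
  - apply infinite_sum_partial_le; [|apply infinite_sum_geom; lra].
    intros k. apply Rmult_le_pos; auto. apply pow_le. lra.
Qed.

Lemma locally_sums_jet N a f : locally_sums a f -> jet N a f.
Proof.
  revert a f. induction N as [|N IH]; intros a f H; [now apply locally_sums_bounded|].
  destruct (locally_sums_split _ _ H) as [f1 [H1 H2]]. exists f1. auto.
Qed.

Lemma locally_sums_unique a b f : locally_sums a f -> locally_sums b f -> forall n, a n = b n.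
Proof.
  intros Ha Hb n. apply (jet_unique (S n) a b f); auto using locally_sums_jet.
Qed.

Lemma locally_sums_0 a f : locally_sums a f -> f 0 = a O.
Proof. intros [r [Hr H]]. apply Cpser_0, H. now rewrite Cmod_0. Qed.

Lemma has_expansion_locally_sums f z0 a :
  has_expansion f z0 a <-> locally_sums a (fun h => f (z0 + h)).
Proof.
  split; intros [r [Hr H]]; exists r; split; auto.
  - intros z Hz. specialize (H (z0 + z)). replace (z0 + z - z0) with z in H by ring.
    apply is_pseries_Cpser. auto.
  - intros z Hz. specialize (H (z - z0) Hz). replace (z0 + (z - z0)) with z in H by ring.
    now apply is_pseries_Cpser.
Qed.

(** The difference quotient at [z0] is itself a power series in [x - z0], with
    constant term [a 1]. *)
Lemma has_expansion_derive f z0 a : has_expansion f z0 a -> C_derive f z0 = a 1%nat.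
Proof.
  intros H. apply has_expansion_locally_sums in H.
  pose proof (locally_sums_0 _ _ H) as E0. simpl in E0. replace (z0 + 0) with z0 in E0 by ring.
  destruct (locally_sums_split _ _ H) as [f1 [H1 H2]].
  destruct (jet_lim _ _ _ (locally_sums_jet 1 _ _ H1)) as [K [K0 HK]].
  apply is_C_lim_unique.
  apply (@filterlim_locally _ _ _ _). intros eps.
  destruct (near0_and _ _ (near0_and _ _ H2 HK) (near0_linear_lt K eps K0 (cond_pos eps)))
    as [d [Hd HH]].
  assert (Hd2 : (0 < d / sqrt 2)%R).
  { apply Rdiv_lt_0_compat; auto. apply sqrt_lt_R0; lra. }
  exists (mkposreal _ Hd2). intros x Hx Hne. change C in x.
  apply C_NormedModule_mixin_compat2 in Hx. simpl in Hx.
  replace (sqrt 2 * (d / sqrt 2))%R with d in Hx.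
  2:{ field. apply Rgt_not_eq, sqrt_lt_R0; lra. }
  assert (Hxz : x - z0 <> 0).
  { intros E. apply Hne. change (x = z0). replace x with (x - z0 + z0) by ring. rewrite E. ring. }
  destruct (HH (x - z0) Hxz Hx) as [[E1 E2] E3].
  apply C_NormedModule_mixin_compat1.
  change (Cmod ((f x - f z0) / (x - z0) - a 1%nat) < eps)%R.
  replace (z0 + (x - z0)) with x in E1 by ring. rewrite E1, E0.
  replace ((a 0%nat + (x - z0) * f1 (x - z0) - a 0%nat) / (x - z0)) with (f1 (x - z0))
    by (field; auto).
  lra.
Qed.

(** * The maximum principle *)

Lemma Cmod_le_abs (z : C) : (Cmod z <= Rabs (fst z) + Rabs (snd z))%R.
Proof.
  unfold Cmod. rewrite <- (sqrt_pow2 (Rabs (fst z) + Rabs (snd z)))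
    by (pose proof (Rabs_pos (fst z)); pose proof (Rabs_pos (snd z)); lra).
  apply sqrt_le_1_alt. rewrite <- (pow2_abs (fst z)), <- (pow2_abs (snd z)).
  pose proof (Rabs_pos (fst z)); pose proof (Rabs_pos (snd z)). nra.
Qed.

Lemma list_argmax {T : Type} (w : T -> R) (l : list T) (x0 : T) :
  In x0 l -> exists x, In x l /\ forall y, In y l -> (w y <= w x)%R.
Proof.
  revert x0. induction l as [|t l IH]; intros x0 Hx; [destruct Hx|].
  destruct l as [|t' l'].
  - exists t. split; [now left|]. intros y [<-|[]]. lra.
  - destruct (IH t' (or_introl eq_refl)) as [x [H1 H2]].
    destruct (Rle_lt_dec (w t) (w x)) as [L|L].
    + exists x. split; [now right|]. intros y [<-|H]; auto.
    + exists t. split; [now left|]. intros y [<-|H]; [lra|]. specialize (H2 y H). lra.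
Qed.

(** An upper semicontinuous function that does not attain its supremum is, near
    every point, smaller than one of its values; by compactness finitely many of
    these values suffice, and the largest of them would be larger than itself. *)
Lemma disk_max (Phi : C -> R) (r : R) : (0 <= r)%R ->
  (forall z, (Cmod z <= r)%R -> forall e, (0 < e)%R -> exists d, (0 < d)%R /\
     forall w, (Cmod (w - z) < d)%R -> (Phi w < Phi z + e)%R) ->
  exists z, (Cmod z <= r)%R /\ forall w, (Cmod w <= r)%R -> (Phi w <= Phi z)%R.
Proof.
  intros Hr Husc. apply NNPP. intros Hno.
  assert (Hbig : forall z, (Cmod z <= r)%R -> exists w, (Cmod w <= r)%R /\ (Phi z < Phi w)%R).
  { intros z Hz. apply NNPP. intros H. apply Hno. exists z. split; auto.
    intros w Hw. apply Rnot_lt_le. intros L. apply H. now exists w. }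
  assert (Hloc : forall t : Compactness.Tn 2 R, exists p : posreal * C,
    (Cmod (snd p) <= r)%R /\ forall w : C, (Cmod w <= r)%R ->
      (Rabs (fst w - fst t) < fst p)%R -> (Rabs (snd w - fst (snd t)) < fst p)%R ->
      (Phi w < Phi (snd p))%R).
  { intros [x [y []]]. simpl. destruct (Rle_lt_dec (Cmod (x, y)) r) as [L|L].
    - destruct (Hbig _ L) as [w [Hw Hlt]].
      destruct (Husc _ L (Phi w - Phi (x, y))%R) as [d [Hd Hdw]]; [lra|].
      assert (Hd2 : (0 < d / 2)%R) by lra.
      exists (mkposreal _ Hd2, w). simpl. split; auto. intros v Hv H1 H2.
      specialize (Hdw v). assert (Cmod (v - (x, y)%R) < d)%R.
      { eapply Rle_lt_trans; [apply Cmod_le_abs|]. 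
        destruct v as [v1 v2]; simpl in *.
        replace (v1 + - x)%R with (v1 - x)%R by ring.
        replace (v2 + - y)%R with (v2 - y)%R by ring. lra. }
      specialize (Hdw H). lra.
    - assert (Hd : (0 < (Cmod (x, y) - r) / 2)%R) by lra.
      exists (mkposreal _ Hd, RtoC 0). simpl. split; [now rewrite Cmod_0|].
      intros v Hv H1 H2. exfalso.
      pose proof (Cmod_minus_ge (x, y) v) as H3. rewrite Cmod_sym in H3.
      pose proof (Cmod_le_abs (v - (x, y)%R)) as H4.
      destruct v as [v1 v2]; simpl in *.
      replace (v1 + - x)%R with (v1 - x)%R in H4 by ring.
      replace (v2 + - y)%R with (v2 - y)%R in H4 by ring. lra. }
  set (p := fun t => proj1_sig (constructive_indefinite_description _ (Hloc t))).
  assert (Hp : forall t, (Cmod (snd (p t)) <= r)%R /\ forall w : C, (Cmod w <= r)%R ->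
      (Rabs (fst w - fst t) < fst (p t))%R -> (Rabs (snd w - fst (snd t)) < fst (p t))%R ->
      (Phi w < Phi (snd (p t)))%R).
  { intros t. unfold p. destruct (constructive_indefinite_description _ (Hloc t)). auto. }
  apply (compactness_list 2 (- r, (- r, tt))%R (r, (r, tt))%R (fun t => fst (p t))).
  intros [l Hl].
  assert (Hin : forall w : C, (Cmod w <= r)%R -> exists t, In t l /\ (Phi w < Phi (snd (p t)))%R).
  { intros w Hw. assert (Hb : bounded_n 2 (- r, (- r, tt))%R (r, (r, tt))%R (fst w, (snd w, tt))).
    { pose proof (Rmax_Cmod w) as M. pose proof (Rmax_l (Rabs (fst w)) (Rabs (snd w))).
      pose proof (Rmax_r (Rabs (fst w)) (Rabs (snd w))).
      simpl. repeat split; unfold Rabs in *; destruct (Rcase_abs (fst w)), (Rcase_abs (snd w)); lra. }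
    destruct (Hl _ Hb) as [t [H1 [_ H2]]].
    exists t. split; auto. destruct t as [t1 [t2 []]].
      destruct H2 as [H2 [H3 _]]. now apply (proj2 (Hp _)). }
  destruct (Hin (RtoC 0)) as [t0 [Ht0 _]]; [now rewrite Cmod_0|].
  destruct (list_argmax (fun t => Phi (snd (p t))) l t0 Ht0) as [t [Ht Hmax]].
  destruct (Hin (snd (p t)) (proj1 (Hp t))) as [t' [Ht' Hlt]].
  specialize (Hmax t' Ht'). lra.
Qed.

(** A function on the unit disk with Taylor jets of all orders at every point:
    the form of analyticity in which quotients and removable singularities need
    no power series manipulations. *)
Definition smooth (g : C -> C) : Prop :=
  forall z0 : C, (Cmod z0 < 1)%R -> forall N, exists a : nat -> C,
    a O = g z0 /\ jet N a (fun h => g (z0 + h)).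

Lemma smooth_continuous g (z : C) : smooth g -> (Cmod z < 1)%R -> exists K d : R,
  (0 <= K)%R /\ (0 < d)%R /\
  forall w : C, (Cmod (w - z) < d)%R -> (Cmod (g w - g z) <= K * Cmod (w - z))%R.
Proof.
  intros Hg Hz. destruct (Hg z Hz 1%nat) as [a [E H]].
  destruct (jet_lim _ _ _ H) as [K [K0 [d [Hd HK]]]].
  exists K, d. repeat split; auto. intros w Hw.
  destruct (Ceq_dec (w - z) 0) as [W|W].
  - replace w with z. 
    + replace (g z - g z) with (RtoC 0) by ring. replace (z - z) with (RtoC 0) by ring.
      rewrite Cmod_0. lra.
    + replace w with (w - z + z) by ring. rewrite W. ring.
  - specialize (HK (w - z) W Hw). replace (z + (w - z)) with w in HK by ring. now rewrite <- E.
Qed.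

(** Orthogonality of the powers of [h] over [h = s], [- s], [i s], [- i s]: the
    sum of the squares is [4 (|p0| ^ 2 + s ^ 2 |p1| ^ 2 + s ^ 4 |p2| ^ 2)]. *)
Lemma square_average (p0 p1 p2 : C) (s : R) :
  (Cmod (p0 + RtoC s * (p1 + RtoC s * p2)) ^ 2
   + Cmod (p0 + - RtoC s * (p1 + - RtoC s * p2)) ^ 2
   + Cmod (p0 + Ci * RtoC s * (p1 + Ci * RtoC s * p2)) ^ 2
   + Cmod (p0 + - (Ci * RtoC s) * (p1 + - (Ci * RtoC s) * p2)) ^ 2
   >= 4 * Cmod p0 ^ 2)%R.
Proof.
  rewrite !Cmod2_alt. destruct p0 as [a b], p1 as [c d], p2 as [e f]. simpl.
  match goal with |- (?x >= ?y)%R =>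
    replace x with (4 * (a ^ 2 + b ^ 2 + s ^ 2 * (c ^ 2 + d ^ 2) + s ^ 4 * (e ^ 2 + f ^ 2)))%R
      by ring end.
  assert (0 <= s ^ 2 * (c ^ 2 + d ^ 2))%R
    by (apply Rmult_le_pos; [apply pow2_ge_0|pose proof (pow2_ge_0 c); pose proof (pow2_ge_0 d); lra]).
  assert (0 <= s ^ 4 * (e ^ 2 + f ^ 2))%R.
  { apply Rmult_le_pos; [replace (s ^ 4)%R with ((s ^ 2) ^ 2)%R by ring; apply pow2_ge_0
      |pose proof (pow2_ge_0 e); pose proof (pow2_ge_0 f); lra]. }
  lra.
Qed.

Lemma Cmod2_plus_ge (P E : C) (A B : R) : (Cmod P <= A)%R -> (Cmod E <= B)%R ->
  (Cmod P ^ 2 - 2 * A * B <= Cmod (P + E) ^ 2)%R.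
Proof.
  intros HP HE. pose proof (Cmod_ge_0 P). pose proof (Cmod_ge_0 E).
  pose proof (Cmod_minus_ge P (- E)) as H1. replace (P - - E) with (P + E) in H1 by ring.
  rewrite Cmod_opp in H1. pose proof (Cmod_ge_0 (P + E)).
  assert (Cmod P * Cmod E <= A * B)%R by (apply Rmult_le_compat; auto).
  destruct (Rle_lt_dec (Cmod P) (Cmod E)); nra.
Qed.

(** Over the four points [z + h] with [h = s], [- s], [i s], [- i s] the average of
    [|g| ^ 2] is at least [|g z| ^ 2 - O (s ^ 3)], by [square_average], while the
    term in [eps] gains [eps * s ^ 2]. *)
Lemma no_interior_max g (z : C) (eps r : R) : smooth g -> (0 < eps)%R ->
  (Cmod z < r)%R -> (r < 1)%R ->
  exists w : C, (Cmod w <= r)%R /\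
    (Cmod (g z) ^ 2 + eps * Cmod z ^ 2 < Cmod (g w) ^ 2 + eps * Cmod w ^ 2)%R.
Proof.
  intros Hg He Hz Hr. destruct (Hg z ltac:(lra) 3%nat) as [a [E0 [g1 [H1 [g2 [H2 [g3 [H3 [K0 HK]]]]]]]]].
  set (K := Rabs K0).
  assert (HK' : near0 (fun h => (Cmod (g3 h) <= K)%R)).
  { apply (near0_impl _ _) with (2 := HK). intros h _ L. pose proof (Rle_abs K0). unfold K. lra. }
  (* [A] bounds the quadratic part of the jet, and [K] its cubic remainder. *)
  set (A := (Cmod (a 0%nat) + Cmod (a 1%nat) + Cmod (a 2%nat))%R).
  assert (HA : (0 <= A)%R).
  { unfold A. pose proof (Cmod_ge_0 (a 0%nat)); pose proof (Cmod_ge_0 (a 1%nat));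
      pose proof (Cmod_ge_0 (a 2%nat)); lra. }
  assert (HK0 : (0 <= K)%R) by apply Rabs_pos.
  destruct (near0_and _ _ (near0_and _ _ H1 H2) (near0_and _ _ H3
    (near0_and _ _ HK' (near0_and _ _ (near0_lt 1 Rlt_0_1)
      (near0_and _ _ (near0_lt (r - Cmod z) ltac:(lra))
        (near0_linear_lt (2 * A * K) eps ltac:(repeat apply Rmult_le_pos; lra) He)))))) as [d [Hd HH]].
  set (s := (d / 2)%R). assert (Hs : (0 < s < d)%R) by (unfold s; lra). clearbody s.
  assert (Hpt : forall h : C, Cmod h = s ->
    (Cmod (z + h) <= r)%R /\
    (Cmod (a 0%nat + h * (a 1%nat + h * a 2%nat)) ^ 2 - 2 * A * (K * s ^ 3)
      <= Cmod (g (z + h)%C) ^ 2)%R /\ (s < 1)%R /\ (2 * A * K * s < eps)%R).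
  { intros h Hh. assert (h0 : h <> 0) by (intros E; rewrite E, Cmod_0 in Hh; lra).
    destruct (HH h h0) as [[E1 E2] [E3 [L1 [L2 [L3 L4]]]]]; [lra|].
    rewrite Hh in *. repeat split; auto.
    - eapply Rle_trans; [apply Cmod_triangle|]. rewrite Hh. lra.
    - rewrite E1, E2, E3.
      replace (a 0%nat + h * (a 1%nat + h * (a 2%nat + h * g3 h))) with
        (a 0%nat + h * (a 1%nat + h * a 2%nat) + h ^ 3 * g3 h) by ring.
      apply Cmod2_plus_ge.
      + pose proof (Cmod_ge_0 (a 1%nat)); pose proof (Cmod_ge_0 (a 2%nat)).
        pose proof (Cmod_triangle (a 0%nat) (h * (a 1%nat + h * a 2%nat))) as T1.
        pose proof (Cmod_triangle (a 1%nat) (h * a 2%nat)) as T2.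
        rewrite !Cmod_mult, Hh in T1, T2. unfold A.
        pose proof (Cmod_ge_0 (a 1%nat + h * a 2%nat)). nra.
      + rewrite Cmod_mult, Cmod_pow, Hh, Rmult_comm.
        apply Rmult_le_compat_r; [apply pow_le; lra|exact L1]. }
  assert (Ms : Cmod (RtoC s) = s) by (rewrite Cmod_R; apply Rabs_pos_eq; lra).
  destruct (Hpt (RtoC s) Ms) as [D1 [G1 [S1 S2]]].
  destruct (Hpt (- RtoC s)) as [D2 [G2 _]]; [now rewrite Cmod_opp|].
  destruct (Hpt (Ci * RtoC s)) as [D3 [G3 _]]; [rewrite Cmod_mult, Cmod_Ci; lra|].
  destruct (Hpt (- (Ci * RtoC s))) as [D4 [G4 _]]; [rewrite Cmod_opp, Cmod_mult, Cmod_Ci; lra|].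
  pose proof (square_average (a 0%nat) (a 1%nat) (a 2%nat) s) as SA. rewrite E0 in *.
  assert (Q : (Cmod (z + RtoC s) ^ 2 + Cmod (z + - RtoC s) ^ 2 + Cmod (z + Ci * RtoC s) ^ 2
     + Cmod (z + - (Ci * RtoC s)) ^ 2 = 4 * Cmod z ^ 2 + 4 * s ^ 2)%R).
  { rewrite !Cmod2_alt. destruct z as [x y]; simpl. ring. }
  assert (F : (2 * A * (K * s ^ 3) < eps * s ^ 2)%R).
  { replace (2 * A * (K * s ^ 3))%R with (2 * A * K * s * s ^ 2)%R by ring.
    apply Rmult_lt_compat_r; auto. apply pow_lt; lra. }
  apply NNPP. intros Hno.
  assert (N : forall w : C, (Cmod w <= r)%R ->
    (Cmod (g w) ^ 2 + eps * Cmod w ^ 2 <= Cmod (g z) ^ 2 + eps * Cmod z ^ 2)%R).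
  { intros w Hw. apply Rnot_lt_le. intros L. apply Hno. now exists w. }
  pose proof (N _ D1). pose proof (N _ D2). pose proof (N _ D3). pose proof (N _ D4).
  apply (f_equal (Rmult eps)) in Q.
  ring_simplify in Q. lra.
Qed.

Lemma le_of_square_le x M : (0 <= M)%R -> (forall e, (0 < e)%R -> (x ^ 2 <= M ^ 2 + e)%R) ->
  (x <= M)%R.
Proof.
  intros HM H. assert (x ^ 2 <= M ^ 2)%R by (apply le_epsilon; exact H). nra.
Qed.

(** Applied to [|g| ^ 2 + e |z| ^ 2], whose maximum on the closed disk must lie on
    the circle, with [e] tending to [0]. *)
Lemma maximum_principle g (r M : R) : smooth g -> (0 <= r < 1)%R -> (0 <= M)%R ->
  (forall z : C, Cmod z = r -> (Cmod (g z) <= M)%R) ->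
  forall z : C, (Cmod z <= r)%R -> (Cmod (g z) <= M)%R.
Proof.
  intros Hg Hr HM Hb z Hz. apply le_of_square_le; auto. intros e He.
  destruct (disk_max (fun z => Cmod (g z) ^ 2 + e * Cmod z ^ 2)%R r) as [w [Hw Hmax]]; [lra| |].
  - clear z Hz. intros z Hz eta Heta.
    destruct (smooth_continuous g z Hg ltac:(lra)) as [K [d [HK [Hd Hc]]]].
    (* Bounds the growth rate at [z] of the function to be maximised. *)
    set (B := ((2 * Cmod (g z) + K + 2) * K + e * (2 * Cmod z + 2))%R).
    pose proof (Cmod_ge_0 (g z)). pose proof (Cmod_ge_0 z).
    assert (HB : (0 <= B)%R) by (unfold B; apply Rplus_le_le_0_compat; apply Rmult_le_pos; lra).
    assert (P : (0 < eta / (B + 1))%R) by (apply Rdiv_lt_0_compat; lra).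
    exists (Rmin (Rmin d 1) (eta / (B + 1))). split; [repeat apply Rmin_pos; lra|].
    intros w Hw. pose proof (Rmin_l (Rmin d 1) (eta / (B + 1))).
    pose proof (Rmin_r (Rmin d 1) (eta / (B + 1))).
    pose proof (Rmin_l d 1). pose proof (Rmin_r d 1).
    specialize (Hc w ltac:(lra)). set (x := Cmod (w - z)) in *.
    assert (Hx : (0 <= x)%R) by apply Cmod_ge_0.
    assert (Hx' : (x * (B + 1) < eta)%R).
    { replace eta with (eta / (B + 1) * (B + 1))%R by (field; lra).
      apply Rmult_lt_compat_r; lra. }
    pose proof (Cmod_minus_ge (g w) (g z)). pose proof (Cmod_minus_ge w z).
    fold x in H6. pose proof (Cmod_ge_0 (g w)). pose proof (Cmod_ge_0 w).
    assert (U1 : (Cmod (g w) ^ 2 <= (Cmod (g z) + K * x) ^ 2)%R) by (apply pow_incr; lra).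
    assert (U2 : (Cmod w ^ 2 <= (Cmod z + x) ^ 2)%R) by (apply pow_incr; lra).
    assert (V1 : ((Cmod (g z) + K * x) ^ 2 <= Cmod (g z) ^ 2 + (2 * Cmod (g z) + K + 2) * K * x)%R).
    { assert (0 <= K * x)%R by (apply Rmult_le_pos; lra).
      assert (K * x * (K * x) <= K * x * K)%R by (apply Rmult_le_compat_l; nra). nra. }
    assert (V2 : ((Cmod z + x) ^ 2 <= Cmod z ^ 2 + (2 * Cmod z + 2) * x)%R) by nra.
    assert (V3 : (e * Cmod w ^ 2 <= e * (Cmod z ^ 2 + (2 * Cmod z + 2) * x))%R)
      by (apply Rmult_le_compat_l; lra).
    unfold B in Hx'. nra.
  - destruct (Rle_lt_or_eq_dec _ _ Hw) as [L|L].
    + destruct (no_interior_max g w e r Hg He L ltac:(lra)) as [v [Hv Hlt]].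
      specialize (Hmax v Hv). lra.
    + specialize (Hmax z Hz). specialize (Hb w L). rewrite L in Hmax.
      pose proof (Cmod_ge_0 (g w)). pose proof (pow2_ge_0 (Cmod z)).
      assert (Cmod (g w) ^ 2 <= M ^ 2)%R by (apply pow_incr; lra).
      assert (r ^ 2 <= 1)%R by nra.
      assert (e * r ^ 2 <= e * 1)%R by (apply Rmult_le_compat_l; lra).
      assert (0 <= e * Cmod z ^ 2)%R by (apply Rmult_le_pos; lra). lra.
Qed.

(** * Schwarz's lemma and the Schur algorithm *)

Lemma jet_at_0 N a g : jet N a (fun h => g (0 + h)) <-> jet N a g.
Proof.
  split; apply jet_ext; auto; apply near0_all; intros h _; f_equal; ring.
Qed.

Lemma smooth_jet_0 g : smooth g -> forall N, exists a : nat -> C, a O = g 0 /\ jet N a g.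
Proof.
  intros Hg N. destruct (Hg 0 ltac:(rewrite Cmod_0; lra) N) as [a [E H]].
  exists a. split; auto. now apply jet_at_0.
Qed.

Lemma smooth_jet_value g N a : smooth g -> jet (S N) a g -> a O = g 0.
Proof.
  intros Hg H. destruct (smooth_jet_0 g Hg 1%nat) as [b [E Hb]]. rewrite <- E.
  exact (jet_lim_unique _ _ _ _ _ H Hb).
Qed.

Lemma smooth_const c : smooth (fun _ => c).
Proof. intros z0 _ N. eexists. split; [|apply (jet_const N c)]. reflexivity. Qed.

Lemma smooth_plus g k : smooth g -> smooth k -> smooth (fun z => g z + k z).
Proof.
  intros Hg Hk z0 Hz N. destruct (Hg z0 Hz N) as [a [Ea Ha]], (Hk z0 Hz N) as [b [Eb Hb]].
  exists (fun n => a n + b n). split; [now rewrite Ea, Eb|now apply jet_plus].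
Qed.

Lemma smooth_mult g k : smooth g -> smooth k -> smooth (fun z => g z * k z).
Proof.
  intros Hg Hk z0 Hz N. destruct (Hg z0 Hz N) as [a [Ea Ha]], (Hk z0 Hz N) as [b [Eb Hb]].
  exists (conv a b). split; [unfold conv; simpl; now rewrite Ea, Eb|now apply jet_mult].
Qed.

Lemma smooth_inv g : smooth g -> (forall z : C, (Cmod z < 1)%R -> g z <> 0) ->
  smooth (fun z => / g z).
Proof.
  intros Hg H0 z0 Hz N. destruct (Hg z0 Hz (S N)) as [a [Ea Ha]].
  pose proof (proj1 (Cmod_gt_0 _) (H0 z0 Hz)) as P.
  destruct (jet_lim _ _ _ Ha) as [K [K0 HK]].
  destruct (jet_inv N a (fun h => g (z0 + h)) (Cmod (g z0) / 2)%R) as [b [Eb Hb]].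
  - lra.
  - apply (near0_impl _ _) with (2 := near0_and _ _ HK
      (near0_linear_lt K (Cmod (g z0) / 2) K0 ltac:(lra))).
    intros h _ [L1 L2]. rewrite Ea in L1. rewrite Cmod_sym in L1.
    pose proof (Cmod_minus_ge (g z0) (g z0 - g (z0 + h))) as T.
    replace (g z0 - (g z0 - g (z0 + h))) with (g (z0 + h)) in T by ring. lra.
  - rewrite Ea. auto.
  - now apply jet_S.
  - exists b. split; [now rewrite Eb, Ea|exact Hb].
Qed.

(** The quotient has the jets of [g] shifted by one; its value at [0] is fixed by
    the jet of order [2]. *)
Lemma smooth_div_id g : smooth g -> g 0 = 0 ->
  exists phi, smooth phi /\ forall z : C, g z = z * phi z.
Proof.
  intros Hg E0. destruct (smooth_jet_0 g Hg 2%nat) as [c [Ec Hc]].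
  exists (fun z => if Ceq_dec z 0 then c 1%nat else g z / z). split.
  2:{ intros z. destruct (Ceq_dec z 0) as [E|E]; [rewrite E, E0; ring|field; auto]. }
  intros z0 Hz N. destruct (Ceq_dec z0 0) as [E|E].
  - destruct (smooth_jet_0 g Hg (S (S N))) as [a [Ea Ha]].
    exists (fun n => a (S n)). split.
    + apply (jet_unique 2 a c g); auto. apply (jet_le _ (S (S N))); auto. lia.
    + rewrite E.
      apply (proj2 (jet_at_0 N _ (fun z => if Ceq_dec z 0 then c 1%nat else g z / z))).
      apply jet_S in Ha. destruct Ha as [g1 [H1 H2]].
      apply (jet_ext _ _ _ g1 _ (fun n _ => eq_refl)) with (2 := H2).
      apply (near0_impl _ _) with (2 := H1). intros h h0 H.
      destruct (Ceq_dec h 0); [tauto|]. rewrite H, Ea, E0. field. auto.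
  - destruct (Hg z0 Hz N) as [a [Ea Ha]]. pose proof (proj1 (Cmod_gt_0 _) E) as P.
    assert (Hn : near0 (fun h => (Cmod z0 / 2 <= Cmod (z0 + h))%R)).
    { apply (near0_impl _ _) with (2 := near0_lt (Cmod z0 / 2) ltac:(lra)). intros h _ L.
      pose proof (Cmod_minus_ge z0 (- h)) as T. rewrite Cmod_opp in T.
      replace (z0 - - h) with (z0 + h) in T by ring. lra. }
    destruct (jet_inv N _ _ (Cmod z0 / 2)%R ltac:(lra) Hn E (jet_id N z0)) as [b [Eb Hb]].
    exists (conv a b). split; [unfold conv; simpl; now rewrite Ea, Eb|].
    apply (jet_ext _ _ _ _ _ (fun n _ => eq_refl)) with (2 := jet_mult _ _ _ _ _ Ha Hb).
    apply (near0_impl _ _) with (2 := Hn). intros h _ L.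
    destruct (Ceq_dec (z0 + h) 0) as [E'|_]; [|reflexivity].
    rewrite E', Cmod_0 in L. lra.
Qed.

Definition bounded_by_1 (g : C -> C) : Prop :=
  forall z : C, (Cmod z < 1)%R -> (Cmod (g z) <= 1)%R.

(** On the circle of radius [r] the quotient is at most [1 / r], hence on the
    disk that it bounds; and [r] may be taken arbitrarily close to [1]. *)
Lemma schwarz g : smooth g -> bounded_by_1 g -> g 0 = 0 ->
  exists phi, smooth phi /\ bounded_by_1 phi /\ forall z : C, g z = z * phi z.
Proof.
  intros Hg Hb E0. destruct (smooth_div_id g Hg E0) as [phi [Hphi E]].
  exists phi. split; [|split]; auto. intros z Hz. apply Rnot_lt_le. intros L.
  (* A radius with [Cmod z < r < 1] and [1 / r < Cmod (phi z)]. *)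
  set (r := Rmax ((1 + Cmod z) / 2) ((1 + / Cmod (phi z)) / 2)).
  assert (I : (/ Cmod (phi z) < 1)%R).
  { rewrite <- Rinv_1. apply Rinv_lt_contravar; lra. }
  assert (Hr : (r < 1)%R) by (apply Rmax_lub_lt; lra).
  pose proof (Rmax_l ((1 + Cmod z) / 2) ((1 + / Cmod (phi z)) / 2)) as R1.
  pose proof (Rmax_r ((1 + Cmod z) / 2) ((1 + / Cmod (phi z)) / 2)) as R2.
  fold r in R1, R2. pose proof (Cmod_ge_0 z).
  assert (M : (Cmod (phi z) <= / r)%R).
  { apply (maximum_principle phi r); auto; try lra.
    - left. apply Rinv_0_lt_compat. lra.
    - intros w Hw. specialize (Hb w ltac:(lra)). rewrite E, Cmod_mult, Hw in Hb.
      apply Rmult_le_reg_l with r; [lra|]. rewrite Rinv_r; lra. }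
  assert (r <= / Cmod (phi z))%R.
  { apply Rmult_le_reg_l with (Cmod (phi z)); [lra|]. rewrite Rinv_r by lra.
    apply Rmult_le_compat_r with (r := r) in M; [|lra]. rewrite Rinv_l in M; lra. }
  lra.
Qed.

Lemma moebius_bound (g c : C) : (Cmod g <= 1)%R -> (Cmod c < 1)%R ->
  1 - Cconj c * g <> 0 /\ (Cmod ((g - c) / (1 - Cconj c * g)) <= 1)%R.
Proof.
  intros Hg Hc. pose proof (Cmod_ge_0 g). pose proof (Cmod_ge_0 c).
  assert (N : 1 - Cconj c * g <> 0).
  { apply (proj2 (Cmod_gt_0 _)). pose proof (Cmod_minus_ge 1 (Cconj c * g)) as T.
    rewrite Cmod_1, Cmod_mult, Cmod_conj in T. nra. }
  split; auto. rewrite Cmod_div by auto. pose proof (proj1 (Cmod_gt_0 _) N) as P.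
  apply Rmult_le_reg_r with (1 := P). unfold Rdiv. rewrite Rmult_assoc, Rinv_l by lra.
  rewrite Rmult_1_r, Rmult_1_l.
  assert (I : (Cmod (1 - Cconj c * g) ^ 2 - Cmod (g - c) ^ 2
      = (1 - Cmod c ^ 2) * (1 - Cmod g ^ 2))%R).
  { rewrite !Cmod2_alt. destruct g, c; simpl; ring. }
  assert (0 <= (1 - Cmod c ^ 2) * (1 - Cmod g ^ 2))%R by (apply Rmult_le_pos; nra).
  pose proof (Cmod_ge_0 (g - c)). nra.
Qed.

(** One step of the Schur algorithm: the quotient of Schwarz's lemma for the
    Moebius transform of [g] that vanishes at [0]. *)
Lemma schur_step g : smooth g -> bounded_by_1 g -> (Cmod (g 0) < 1)%R ->
  exists psi, smooth psi /\ bounded_by_1 psi /\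
    forall z : C, (Cmod z < 1)%R -> g z - g 0 = z * (psi z * (1 + - Cconj (g 0) * g z)).
Proof.
  intros Hg Hb H0.
  assert (Hd : forall z : C, (Cmod z < 1)%R -> 1 + - Cconj (g 0) * g z <> 0).
  { intros z Hz. destruct (moebius_bound (g z) (g 0) (Hb z Hz) H0) as [N _].
    intros E. apply N. etransitivity; [|exact E]. ring. }
  destruct (schwarz (fun z => (g z + - g 0) * / (1 + - Cconj (g 0) * g z))) as [psi [H1 [H2 H3]]].
  - apply smooth_mult.
    + apply smooth_plus; auto using smooth_const.
    + apply (smooth_inv (fun z => 1 + - Cconj (g 0) * g z)); auto.
      apply (smooth_plus (fun _ => 1) (fun z => - Cconj (g 0) * g z)); [apply smooth_const|].
      apply (smooth_mult (fun _ => - Cconj (g 0)) g); auto using smooth_const.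
  - intros z Hz. destruct (moebius_bound (g z) (g 0) (Hb z Hz) H0) as [_ B].
    replace ((g z + - g 0) * / (1 + - Cconj (g 0) * g z)) with
      ((g z - g 0) / (1 - Cconj (g 0) * g z)); [exact B|].
    unfold Cdiv, Cminus. replace (- (Cconj (g 0) * g z)) with (- Cconj (g 0) * g z) by ring. reflexivity.
  - ring.
  - exists psi. split; [|split]; auto. intros z Hz.
    replace (z * (psi z * (1 + - Cconj (g 0) * g z)))
      with ((z * psi z) * (1 + - Cconj (g 0) * g z)) by ring.
    rewrite <- H3. field. auto.
Qed.

(** The identity of [schur_step] in terms of coefficients, after division by [z];
    the second factor of the convolution is the jet of [1 - conj (g 0) * g]. *)
Lemma schur_step_coefs g N a : smooth g -> bounded_by_1 g -> (Cmod (g 0) < 1)%R ->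
  jet (S N) a g ->
  exists psi b, smooth psi /\ bounded_by_1 psi /\ jet N b psi /\ b O = psi 0 /\
    forall n, (n < N)%nat -> a (S n) =
      conv b (fun k => match k with O => 1 | _ => 0 end + - Cconj (g 0) * a k) n.
Proof.
  intros Hg Hb H0 Ha. destruct (schur_step g Hg Hb H0) as [psi [H1 [H2 H3]]].
  destruct (smooth_jet_0 psi H1 N) as [b [Eb Jb]].
  exists psi, b. repeat (split; auto).
  pose proof (smooth_jet_value _ _ _ Hg Ha) as Ea.
  pose proof (jet_S _ _ _ Ha) as Ha'. destruct Ha as [g1 [G1 G2]].
  apply (jet_unique N (fun n => a (S n)) _ g1); auto.
  apply (jet_ext _ _ _ (fun h => psi h * (1 + - Cconj (g 0) * g h)) g1 (fun n _ => eq_refl)).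
  - apply (near0_impl _ _) with (2 := near0_and _ _ G1 (near0_lt 1 Rlt_0_1)).
    intros h h0 [E L]. specialize (H3 h L). rewrite <- Ea in H3 at 1.
    apply (f_equal (fun x => / h * x)) in H3. rewrite E in H3 at 1.
    replace (g1 h) with (/ h * (a 0%nat + h * g1 h - a 0%nat)) by (field; auto).
    rewrite H3. field; auto.
  - apply (jet_mult _ _ _ psi (fun h => 1 + - Cconj (g 0) * g h)); auto.
    apply (jet_plus _ _ _ (fun _ => 1) (fun h => - Cconj (g 0) * g h)).
    + apply (jet_const N 1).
    + apply (jet_scal N _ a g); auto.
Qed.

Lemma le_of_scaled X Y B : (forall t, (0 < t < 1)%R -> (X <= Y + (1 - t) * B)%R) -> (X <= Y)%R.
Proof.
  intros H. apply le_epsilon. intros e He. pose proof (Rabs_pos B). pose proof (Rle_abs B).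
  set (d := (e / (Rabs B + e + 1))%R).
  assert (P : (0 < d)%R) by (apply Rdiv_lt_0_compat; lra).
  assert (Q : (d * (Rabs B + e + 1) = e)%R) by (unfold d; field; lra).
  assert (d < 1)%R by nra.
  specialize (H (1 - d)%R ltac:(lra)). nra.
Qed.

Lemma smooth_scaled g (t : R) : smooth g -> bounded_by_1 g -> (0 < t < 1)%R ->
  smooth (fun z => RtoC t * g z) /\ bounded_by_1 (fun z => RtoC t * g z)
  /\ (Cmod (RtoC t * g 0) < 1)%R.
Proof.
  intros Hg Hb Ht.
  assert (B : forall z : C, (Cmod z < 1)%R -> (Cmod (RtoC t * g z) <= t)%R).
  { intros z Hz. rewrite Cmod_mult, Cmod_R, Rabs_pos_eq by lra.
    specialize (Hb z Hz). nra. }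
  split; [|split].
  - apply (smooth_mult (fun _ => RtoC t) g); auto using smooth_const.
  - intros z Hz. specialize (B z Hz). lra.
  - specialize (B 0 ltac:(rewrite Cmod_0; lra)). lra.
Qed.

Lemma Cconj_mult_self (c : C) : Cconj c * c = RtoC (Cmod c ^ 2).
Proof. rewrite Cmod2_conj. ring. Qed.

(** The Schwarz-Pick inequality at the origin. Scaling by [t < 1] makes the Schur
    step available when [|g 0| = 1]. *)
Lemma schwarz_pick g a : smooth g -> bounded_by_1 g -> jet 2 a g ->
  (Cmod (a 1%nat) <= 1 - Cmod (a O) ^ 2)%R.
Proof.
  intros Hg Hb Ha. apply (le_of_scaled _ _ (Cmod (a 1%nat) + 2 * Cmod (a O) ^ 2)).
  intros t Ht. destruct (smooth_scaled g t Hg Hb Ht) as [S1 [S2 S3]].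
  destruct (schur_step_coefs _ 1 _ S1 S2 S3 (jet_scal _ (RtoC t) _ _ Ha))
    as [psi [b [_ [P2 [_ [Eb E]]]]]].
  specialize (E 0%nat ltac:(lia)). unfold conv in E; simpl in E.
  rewrite <- (smooth_jet_value _ _ _ Hg Ha) in *.
  assert (Ht1 : Cmod (RtoC t) = t) by (rewrite Cmod_R; apply Rabs_pos_eq; lra).
  pose proof (Cmod_ge_0 (a 0%nat)) as C0.
  assert (Hx : (0 <= 1 - (t * Cmod (a O)) ^ 2)%R).
  { rewrite Cmod_mult, Ht1 in S3.
    assert (0 <= t * Cmod (a 0%nat))%R by (apply Rmult_le_pos; lra). nra. }
  assert (I : (Cmod (RtoC t * a 1%nat) <= 1 - (t * Cmod (a O)) ^ 2)%R).
  { rewrite E. replace (1 + - Cconj (RtoC t * a 0%nat) * (RtoC t * a 0%nat))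
      with (1 - Cconj (RtoC t * a 0%nat) * (RtoC t * a 0%nat)) by ring.
    rewrite Cconj_mult_self, <- RtoC_minus, Cmod_mult, Cmod_R, Cmod_mult, Ht1.
    rewrite Rabs_pos_eq by exact Hx. rewrite Eb.
    specialize (P2 0 ltac:(rewrite Cmod_0; lra)). nra. }
  rewrite Cmod_mult, Ht1 in I. pose proof (pow2_ge_0 (Cmod (a O))).
  replace ((t * Cmod (a O)) ^ 2)%R with (t ^ 2 * Cmod (a O) ^ 2)%R in I by ring.
  pose proof (pow2_ge_0 (1 - t)).
  assert ((1 - t ^ 2) * Cmod (a O) ^ 2 <= (1 - t) * 2 * Cmod (a O) ^ 2)%R
    by (apply Rmult_le_compat_r; nra).
  nra.
Qed.

(** * The coefficient inequality *)

(** [48 * H_2(2)] in terms of the coefficients of the Schwarz function. *)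
Definition hankel48 (c1 c2 c3 : C) : C :=
  16 * c1 * c3 + 4 * c1 ^ 2 * c2 - 12 * c2 ^ 2 - 7 * c1 ^ 4.

Lemma Cmod_plus_le (x y : C) (X Y : R) : (Cmod x <= X)%R -> (Cmod y <= Y)%R ->
  (Cmod (x + y) <= X + Y)%R.
Proof. intros. pose proof (Cmod_triangle x y). lra. Qed.

(** The triangle inequality after taking out the factor [1 - |g| ^ 2]; the
    resulting bound increases with [Cmod b], as
    [12 + 4 c ^ 2 - 16 c = 4 (1 - c) (3 - c)]. *)
Lemma hankel48_schur_parameters (g b d c2 c3 : C) :
  (Cmod g <= 1)%R -> (Cmod b <= 1)%R -> (Cmod d <= 1 - Cmod b ^ 2)%R ->
  c2 = b * (1 - Cconj g * g) -> c3 = d * (1 - Cconj g * g) - b * Cconj g * c2 ->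
  (Cmod (hankel48 g c2 c3) <= 12)%R.
Proof.
  intros Hg Hb Hd E2 E3. set (c := Cmod g) in *. set (t := Cmod b) in *.
  assert (Hc0 : (0 <= c)%R) by apply Cmod_ge_0. assert (Ht0 : (0 <= t)%R) by apply Cmod_ge_0.
  assert (E : hankel48 g c2 c3 = RtoC (1 - c ^ 2) * (RtoC 16 * g * d + - RtoC 16 * RtoC (c ^ 2) * b ^ 2
     + RtoC 4 * g ^ 2 * b + - RtoC 12 * RtoC (1 - c ^ 2) * b ^ 2) + - RtoC 7 * g ^ 4).
  { unfold c. rewrite RtoC_minus, <- Cconj_mult_self. unfold hankel48. rewrite E3, E2. ring. }
  assert (Hx : (0 <= 1 - c ^ 2)%R) by nra.
  rewrite E. apply Rle_trans with ((1 - c ^ 2) * (16 * c * (1 - t ^ 2) + 16 * c ^ 2 * t ^ 2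
     + 4 * c ^ 2 * t + 12 * (1 - c ^ 2) * t ^ 2) + 7 * c ^ 4)%R.
  - apply Cmod_plus_le.
    + rewrite Cmod_mult, Cmod_R, Rabs_pos_eq by exact Hx. apply Rmult_le_compat_l; auto.
      repeat apply Cmod_plus_le; rewrite ?Cmod_mult, ?Cmod_opp, ?Cmod_pow, ?Cmod_R;
        fold c t; rewrite ?Rabs_pos_eq by (lra || apply pow2_ge_0); try lra.
      apply Rmult_le_compat_l; lra.
    + rewrite Cmod_mult, Cmod_opp, Cmod_pow, Cmod_R, Rabs_pos_eq by lra. fold c. lra.
  - assert (I : (16 * c * (1 - t ^ 2) + 16 * c ^ 2 * t ^ 2
     + 4 * c ^ 2 * t + 12 * (1 - c ^ 2) * t ^ 2 <= 12 + 8 * c ^ 2)%R).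
    { assert (0 <= (1 - t ^ 2) * (4 * ((1 - c) * (3 - c))))%R
        by (apply Rmult_le_pos; [nra|]; apply Rmult_le_pos; [lra|]; apply Rmult_le_pos; lra).
      assert (0 <= 4 * c ^ 2 * (1 - t))%R by (apply Rmult_le_pos; nra). nra. }
    apply Rmult_le_compat_l with (r := (1 - c ^ 2)%R) in I; [|exact Hx].
    assert (0 <= c ^ 4)%R by (apply pow_le; auto). nra.
Qed.

(** Scaling the Schwarz function by [t < 1] keeps the first Schur parameter inside
    the disk. *)
Lemma hankel48_bound w c : smooth w -> bounded_by_1 w -> w 0 = 0 -> jet 4 c w ->
  (Cmod (hankel48 (c 1%nat) (c 2%nat) (c 3%nat)) <= 12)%R.
Proof.
  intros Hw Hb E0 Hc. destruct (schwarz w Hw Hb E0) as [phi [P1 [P2 P3]]].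
  assert (Jphi : jet 3 (fun n => c (S n)) phi).
  { pose proof (smooth_jet_value _ _ _ Hw Hc) as Ec. destruct Hc as [w1 [W1 W2]].
    apply (jet_ext _ _ _ w1 phi (fun n _ => eq_refl)) with (2 := W2).
    apply (near0_impl _ _) with (2 := W1). intros h h0 E. rewrite Ec, E0, P3 in E.
    apply (f_equal (fun x => / h * x)) in E.
    replace (phi h) with (/ h * (h * phi h)) by (field; auto). rewrite E. field; auto. }
  (* The parts of [hankel48] of degree 2, 3 and 4, which scale differently. *)
  set (U := 16 * c 1%nat * c 3%nat - 12 * c 2%nat ^ 2).
  set (V := 4 * c 1%nat ^ 2 * c 2%nat). set (W := - RtoC 7 * c 1%nat ^ 4).
  apply (le_of_scaled _ _ (2 * Cmod U + 3 * Cmod V + 4 * Cmod W)). intros t Ht.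
  destruct (smooth_scaled phi t P1 P2 Ht) as [S1 [S2 S3]].
  destruct (schur_step_coefs _ 2 _ S1 S2 S3 (jet_scal _ (RtoC t) _ _ Jphi))
    as [psi [b [Q1 [Q2 [Q3 [Eb E]]]]]].
  pose proof (E 0%nat ltac:(lia)) as E2. pose proof (E 1%nat ltac:(lia)) as E3.
  unfold conv in E2, E3; simpl in E2, E3.
  rewrite <- (smooth_jet_value _ _ _ P1 Jphi) in *.
  pose proof (schwarz_pick psi b Q1 Q2 Q3) as SP.
  assert (B : (Cmod (hankel48 (RtoC t * c 1%nat) (RtoC t * c 2%nat) (RtoC t * c 3%nat)) <= 12)%R).
  { apply (hankel48_schur_parameters _ (b 0%nat) (b 1%nat)); auto.
    - lra.
    - rewrite Eb. apply Q2. rewrite Cmod_0. lra.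
    - rewrite E2. ring.
    - rewrite E3. ring. }
  replace (hankel48 (c 1%nat) (c 2%nat) (c 3%nat)) with
    (hankel48 (RtoC t * c 1%nat) (RtoC t * c 2%nat) (RtoC t * c 3%nat)
      + (RtoC (1 - t ^ 2) * U + RtoC (1 - t ^ 3) * V + RtoC (1 - t ^ 4) * W)).
  2:{ rewrite !RtoC_minus, !RtoC_pow. unfold hankel48, U, V, W. ring. }
  apply Cmod_plus_le; auto.
  assert (T2 : (0 <= 1 - t ^ 2 <= (1 - t) * 2)%R) by nra.
  assert (T3 : (0 <= 1 - t ^ 3 <= (1 - t) * 3)%R).
  { replace (1 - t ^ 3)%R with ((1 - t) * (1 + t + t ^ 2))%R by ring. nra. }
  assert (T4 : (0 <= 1 - t ^ 4 <= (1 - t) * 4)%R).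
  { replace (1 - t ^ 4)%R with ((1 - t ^ 2) * (1 + t ^ 2))%R by ring. nra. }
  replace ((1 - t) * (2 * Cmod U + 3 * Cmod V + 4 * Cmod W))%R with
    ((1 - t) * 2 * Cmod U + (1 - t) * 3 * Cmod V + (1 - t) * 4 * Cmod W)%R by ring.
  repeat apply Cmod_plus_le; rewrite Cmod_mult, Cmod_R, Rabs_pos_eq by lra;
    (apply Rmult_le_compat_r; [apply Cmod_ge_0|lra]).
Qed.

(** * The upper bound *)

Lemma Cmod_Re_bounds (v : C) : (0 <= (Cmod v + Re v) / 2)%R /\ (0 <= (Cmod v - Re v) / 2)%R.
Proof.
  pose proof (re_le_Cmod v) as H. apply Rabs_le_between in H. lra.
Qed.

Lemma principal_sqrt_sqr (v : C) : principal_sqrt v ^ 2 = v.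
Proof.
  destruct (Cmod_Re_bounds v) as [P1 P2]. unfold principal_sqrt.
  set (x := sqrt ((Cmod v + Re v) / 2)). set (y := sqrt ((Cmod v - Re v) / 2)).
  assert (Hx : (x * x = (Cmod v + Re v) / 2)%R) by (apply sqrt_sqrt; exact P1).
  assert (Hy : (y * y = (Cmod v - Re v) / 2)%R) by (apply sqrt_sqrt; exact P2).
  assert (Hxy : (2 * (x * y) = Rabs (Im v))%R).
  { unfold x, y. rewrite <- sqrt_mult by auto.
    replace ((Cmod v + Re v) / 2 * ((Cmod v - Re v) / 2))%R with ((Im v / 2) ^ 2)%R.
    - replace ((Im v / 2) ^ 2)%R with (Rsqr (Im v / 2)) by (unfold Rsqr; ring).
      rewrite sqrt_Rsqr_abs. unfold Rdiv. rewrite Rabs_mult, (Rabs_pos_eq (/ 2)) by lra. field.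
    - pose proof (Cmod2_alt v). nra. }
  clearbody x y. destruct v as [a b]. unfold Re, Im in *. simpl fst in *. simpl snd in *.
  simpl. destruct (Rle_dec 0 b) as [L|L].
  - rewrite Rabs_pos_eq in Hxy by lra. unfold Cmult; simpl. f_equal; nra.
  - rewrite Rabs_left in Hxy by lra. unfold Cmult; simpl. f_equal; nra.
Qed.

Lemma principal_sqrt_Re (v : C) : (0 <= Re (principal_sqrt v))%R.
Proof. apply sqrt_pos. Qed.

(** [q w - (1 + w + w ^ 2 / 2)] is the difference between the root [S] of
    [1 + w ^ 2] and [1 + w ^ 2 / 2], whose squares differ by [w ^ 4 / 4]; their
    sum is bounded away from [0] as [Re S >= 0]. *)
Lemma q_expansion (w : C) : (Cmod w <= 1)%R ->
  (Cmod (q w - (1 + w + / 2 * (w * w))) <= Cmod w ^ 4)%R.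
Proof.
  intros Hw. unfold q. pose proof (principal_sqrt_sqr (1 + w ^ 2)) as E.
  pose proof (principal_sqrt_Re (1 + w ^ 2)) as P. set (S := principal_sqrt (1 + w ^ 2)) in *.
  clearbody S.
  set (T := S + (1 + / 2 * (w * w))).
  assert (F : (S + w - (1 + w + / 2 * (w * w))) * T = - (RtoC (/ 4) * w ^ 4)).
  { unfold T. rewrite RtoC_inv by lra.
    replace ((S + w - (1 + w + / 2 * (w * w))) * (S + (1 + / 2 * (w * w))))
      with (S ^ 2 - (1 + / 2 * (w * w)) ^ 2) by ring.
    rewrite E. field. }
  assert (HT : (/ 2 <= Cmod T)%R).
  { pose proof (re_le_Cmod T) as R1. pose proof (Rle_abs (Re T)) as R2.
    assert (R3 : Re T = (Re S + (1 + Re (/ 2 * (w * w))))%R) by reflexivity.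
    pose proof (re_le_Cmod (/ 2 * (w * w))) as R4. apply Rabs_le_between in R4.
    assert (I2 : Cmod (/ 2) = (/ 2)%R).
    { rewrite <- RtoC_inv by lra. rewrite Cmod_R. apply Rabs_pos_eq. lra. }
    rewrite !Cmod_mult, I2 in R4. pose proof (Cmod_ge_0 w). nra. }
  apply (f_equal Cmod) in F. rewrite Cmod_mult, Cmod_opp, Cmod_mult, Cmod_pow, Cmod_R in F.
  rewrite Rabs_pos_eq in F by lra.
  pose proof (Cmod_ge_0 (S + w - (1 + w + / 2 * (w * w)))).
  assert (0 <= Cmod w ^ 4)%R by (apply pow_le, Cmod_ge_0). nra.
Qed.

Lemma analytic_smooth g : analytic_in_disk g -> smooth g.
Proof.
  intros Hg z0 Hz N. destruct (Hg z0 Hz) as [a Ha]. apply has_expansion_locally_sums in Ha.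
  exists a. split; [|now apply locally_sums_jet].
  rewrite <- (locally_sums_0 _ _ Ha). f_equal. ring.
Qed.

Lemma q_jet w c : smooth w -> w 0 = 0 -> jet 4 c w ->
  jet 4 (fun n => (match n with O => 1 | _ => 0 end + c n + / 2 * conv c c n) + 0)
    (fun h => q (w h)).
Proof.
  intros Hw E0 Hc. pose proof (smooth_jet_value _ _ _ Hw Hc) as Ec. rewrite E0 in Ec.
  destruct (jet_lim _ _ _ Hc) as [K [K0 HK]].
  apply (jet_ext _ _ _ (fun h => (1 + w h + / 2 * (w h * w h))
     + (q (w h) - (1 + w h + / 2 * (w h * w h)))) _ (fun n _ => eq_refl)).
  { apply near0_all. intros. ring. }
  apply (jet_plus _ _ _ (fun h => 1 + w h + / 2 * (w h * w h))).
  - apply (jet_plus _ _ _ (fun h => 1 + w h) (fun h => / 2 * (w h * w h))).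
    + apply (jet_plus _ _ _ (fun _ => 1) w); auto. apply (jet_const 4 1).
    + apply (jet_scal _ _ _ (fun h => w h * w h)). now apply jet_mult.
  - apply (jet_bigO 4 (K ^ 4)).
    apply (near0_impl _ _) with (2 := near0_and _ _ HK (near0_linear_lt K 1 K0 Rlt_0_1)).
    intros h _ [L1 L2]. rewrite Ec in L1. replace (w h - 0) with (w h) in L1 by ring.
    eapply Rle_trans; [apply q_expansion; lra|].
    rewrite <- Rpow_mult_distr. apply pow_incr. split; auto using Cmod_ge_0.
Qed.

(** Recentering the series at a nearby point [z] makes [C_derive f z] a
    coefficient, namely the sum at [z] of the series differentiated termwise. *)
Lemma derive_locally_sums f a : has_expansion f 0 a ->
  locally_sums (deriv_coef a) (C_derive f).
Proof.
  intros H. apply has_expansion_locally_sums in H.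
  destruct (locally_sums_coef_bound _ _ H) as [rho0 [K [Hr0 HK]]].
  destruct H as [r [Hr H]]. set (rho := Rmin r rho0).
  assert (Hrho : (0 < rho)%R) by now apply Rmin_pos.
  assert (Hc : coef_bound a rho K).
  { split; auto. intros n. eapply Rle_trans; [|apply HK].
    apply Rmult_le_compat_l; [apply Cmod_ge_0|]. apply pow_incr. split; [lra|apply Rmin_r]. }
  exists rho. split; auto. intros z Hz.
  destruct (Cpser_recenter a rho K f z Hc) as [d [H1 H2]]; auto.
  - intros x Hx. replace (f x) with (f (0 + x)) by (f_equal; ring). apply H.
    eapply Rlt_le_trans; [exact Hx|apply Rmin_l].
  - replace (C_derive f z) with (d 1%nat); auto. symmetry. apply has_expansion_derive.
    apply has_expansion_locally_sums. exists (rho - Cmod z)%R. split; [lra|].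
    intros h Hh. apply H1. lra.
Qed.

(** With [f h = h * f1 h], the subordination reads [C_derive f = f1 * q w] near
    [0]; comparing coefficients expresses [a 2], [a 3], [a 4] by those of [w]. *)
Lemma hankel_bound f a : class_S_star q f -> has_expansion f 0 a ->
  (Cmod (hankel_2_2 a) <= 1 / 4)%R.
Proof.
  intros [[Hf [F0 F1]] [Hnz [w [Wa [W0 [Wb Wq]]]]]] Ha.
  pose proof (analytic_smooth _ Wa) as Ws.
  assert (Wb1 : bounded_by_1 w) by (intros z Hz; left; exact (Wb z Hz)).
  destruct (smooth_jet_0 w Ws 4) as [c [Ec Hc]].
  pose proof (hankel48_bound w c Ws Wb1 W0 Hc) as B. rewrite W0 in Ec.
  pose proof (has_expansion_derive _ _ _ Ha) as A1. rewrite F1 in A1.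
  pose proof (locally_sums_jet 4 _ _ (derive_locally_sums _ _ Ha)) as JD.
  apply has_expansion_locally_sums in Ha.
  pose proof (proj1 (jet_at_0 5 a f) (locally_sums_jet 5 _ _ Ha)) as JF.
  assert (A0 : a 0%nat = 0).
  { rewrite <- (locally_sums_0 _ _ Ha). etransitivity; [|exact F0]. f_equal. ring. }
  destruct JF as [f1 [G1 G2]].
  pose proof (q_jet w c Ws W0 Hc) as JQ.
  assert (JP : jet 4 (conv (fun n => a (S n))
      (fun n => (match n with O => 1 | _ => 0 end + c n + / 2 * conv c c n) + 0)) (C_derive f)).
  { apply (jet_ext _ _ _ (fun h => f1 h * q (w h)) _ (fun n _ => eq_refl));
      [|exact (jet_mult _ _ _ _ _ G2 JQ)].
    apply (near0_impl _ _) with (2 := near0_and _ _ G1 (near0_lt 1 Rlt_0_1)).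
    intros h h0 [E L]. rewrite <- (Wq h L). unfold zf'_over_f.
    destruct (Ceq_dec h 0) as [|_]; [tauto|].
    assert (E' : f h = h * f1 h) by (rewrite E, A0; ring).
    pose proof (Hnz h L h0) as N. rewrite E' in N |- *.
    field. split; auto. intros Z. apply N. rewrite Z. ring. }
  assert (E := jet_unique 4 _ _ _ JD JP). clear JD JP JQ.
  pose proof (E 1%nat ltac:(lia)) as E1. pose proof (E 2%nat ltac:(lia)) as E2.
  pose proof (E 3%nat ltac:(lia)) as E3.
  unfold deriv_coef, conv in E1, E2, E3. simpl in E1, E2, E3.
  rewrite <- A1, Ec in E1, E2, E3. 
  repeat rewrite RtoC_plus in E1. repeat rewrite RtoC_plus in E2.
  repeat rewrite RtoC_plus in E3.

  assert (S2 : a 2%nat = c 1%nat).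
  { replace (a 2%nat) with ((1 + 1) * a 2%nat - a 2%nat) by ring. rewrite E1. ring. }
  assert (S3 : a 3%nat = / 2 * c 2%nat + 3 / 4 * c 1%nat ^ 2).
  { replace (a 3%nat) with (/ 2 * ((1 + 1 + 1) * a 3%nat - a 3%nat)) by field.
    rewrite E2, S2. field. }
  assert (S4 : a 4%nat = / 3 * c 3%nat + 5 / 6 * c 1%nat * c 2%nat + 5 / 12 * c 1%nat ^ 3).
  { replace (a 4%nat) with (/ 3 * ((1 + 1 + 1 + 1) * a 4%nat - a 4%nat)) by field.
    rewrite E3, S2, S3. field. }
  assert (EH : hankel48 (c 1%nat) (c 2%nat) (c 3%nat) = RtoC 48 * hankel_2_2 a).
  { unfold hankel48, hankel_2_2. rewrite S2, S3, S4. field. }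
  rewrite EH, Cmod_mult, Cmod_R, Rabs_pos_eq in B by lra. lra.
Qed.

(** * Power series with bounded coefficients *)

Definition coefs_le_1 (a : nat -> C) : Prop := forall n, (Cmod (a n) <= 1)%R.

Lemma coefs_le_1_bound a : coefs_le_1 a -> coef_bound a 1 1.
Proof. intros H. split; [lra|]. intros n. rewrite pow1, Rmult_1_r. apply H. Qed.

Lemma coefs_le_1_sum a : coefs_le_1 a ->
  exists f : C -> C, forall z : C, (Cmod z < 1)%R -> Cpser a z (f z).
Proof.
  intros H. exists (fun z => Cseries (fun n => a n * z ^ n)). intros z Hz.
  apply Cseries_correct. apply (coef_bound_Cpser_exists a 1 1); auto using coefs_le_1_bound.
Qed.

Lemma coefs_le_1_analytic a f : coefs_le_1 a ->
  (forall z : C, (Cmod z < 1)%R -> Cpser a z (f z)) ->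
  analytic_in_disk f /\
  forall z : C, (Cmod z < 1)%R -> Cpser (deriv_coef a) z (C_derive f z).
Proof.
  intros Ha Hf.
  assert (R : forall z : C, (Cmod z < 1)%R -> exists d, has_expansion f z d
                /\ Cpser (deriv_coef a) z (d 1%nat)).
  { intros z Hz.
    destruct (Cpser_recenter a 1 1 f z (coefs_le_1_bound a Ha) Hf Hz) as [d [H1 H2]].
    exists d. split; auto. apply has_expansion_locally_sums. exists (1 - Cmod z)%R.
    split; [lra|]. intros h Hh. apply H1. lra. }
  split.
  - intros z Hz. destruct (R z Hz) as [d [H _]]. now exists d.
  - intros z Hz. destruct (R z Hz) as [d [H1 H2]].
    now rewrite (has_expansion_derive _ _ _ H1).
Qed.

Lemma Cpser_term_le a (z : C) : coefs_le_1 a -> forall n, (Cmod (a n * z ^ n) <= 1 * Cmod z ^ n)%R.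
Proof.
  intros H n. rewrite Cmod_mult, Cmod_pow. apply Rmult_le_compat_r; auto.
  apply pow_le, Cmod_ge_0.
Qed.

Lemma conv_pow a b (z : C) n :
  conv (fun k => a k * z ^ k) (fun k => b k * z ^ k) n = conv a b n * z ^ n.
Proof.
  unfold conv. rewrite Cmult_comm, <- Csum_scal. apply Csum_ext. intros k L.
  replace n with (k + (n - k))%nat at 3 by lia. rewrite Cpow_add_r. ring.
Qed.

Lemma Cpser_mult a b (z x y : C) (va vb : nat -> R) A B : Cpser a z x -> Cpser b z y ->
  (forall n, (Cmod (a n * z ^ n) <= va n)%R) -> (forall n, (Cmod (b n * z ^ n) <= vb n)%R) ->
  infinite_sum va A -> infinite_sum vb B -> Cpser (conv a b) z (x * y).
Proof.
  intros Ha Hb H1 H2 H3 H4.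
  apply (Cser_ext _ _ _ (conv_pow a b z)).
  exact (Cser_mult _ _ _ _ _ _ _ _ Ha Hb H1 H2 H3 H4).
Qed.

Lemma Cpser_mult_le_1 a b (z x y : C) : (Cmod z < 1)%R -> coefs_le_1 a -> coefs_le_1 b ->
  Cpser a z x -> Cpser b z y -> Cpser (conv a b) z (x * y).
Proof.
  intros Hz Ha Hb HA HB.
  assert (G := infinite_sum_geom 1 (Cmod z) (conj (Cmod_ge_0 z) Hz)).
  exact (Cpser_mult _ _ _ _ _ _ _ _ _ HA HB (Cpser_term_le a z Ha) (Cpser_term_le b z Hb) G G).
Qed.

Lemma conv_comm a b n : conv a b n = conv b a n.
Proof.
  unfold conv. revert a b.
  assert (R : forall m (u : nat -> C), Csum u m = Csum (fun k => u (m - k)%nat) m).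
  { induction m as [|m IH]; intros u; [reflexivity|].
    rewrite Csum_shift. simpl Csum at 2. rewrite Nat.sub_diag, (IH (fun k => u (S k))).
    rewrite (Csum_ext (fun k => u (S m - k)%nat) (fun k => u (S (m - k)))); [ring|].
    intros k L. f_equal. lia. }
  intros a b. rewrite R. apply Csum_ext. intros k L.
  replace (n - (n - k))%nat with k by lia. ring.
Qed.

(** [n + 1 = k + (n + 1 - k)] in each term of the convolution. *)
Lemma leibniz_coef a b n : deriv_coef (conv a b) n
  = conv (deriv_coef a) b n + conv a (deriv_coef b) n.
Proof.
  assert (L : forall a b, conv (deriv_coef a) b n
      = Csum (fun k => RtoC (INR k) * (a k * b (S n - k)%nat)) (S n)).
  { intros u v. rewrite Csum_shift. simpl (INR 0). unfold conv, deriv_coef.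
    rewrite Cmult_0_l, Cplus_0_l. apply Csum_ext. intros k _. simpl (S n - S k)%nat. ring. }
  rewrite (conv_comm a (deriv_coef b)), !L. unfold deriv_coef, conv.
  assert (T : Csum (fun k => RtoC (INR k) * (b k * a (S n - k)%nat)) (S n)
    = Csum (fun k => RtoC (INR (S n - k)) * (a k * b (S n - k)%nat)) (S n)).
  { generalize (S n). intros m.
    transitivity (conv (fun k => RtoC (INR k) * b k) a m).
    - apply Csum_ext. intros; ring.
    - rewrite conv_comm. apply Csum_ext. intros; ring. }
  rewrite T, <- Csum_plus, <- Csum_scal. apply Csum_ext. intros k Lk.
  rewrite minus_INR by auto. rewrite RtoC_minus. ring.
Qed.

(** * Power series solutions of a linear differential equation *)

Lemma strong_recursion (F : nat -> (nat -> C) -> C) :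
  (forall n u v, (forall k, (k < n)%nat -> u k = v k) -> F n u = F n v) ->
  exists u, forall n, u n = F n u.
Proof.
  intros HF.
  set (approx := fix approx n : nat -> C := match n with
    | O => fun _ => RtoC 0
    | S m => fun k => if Nat.eqb k m then F m (approx m) else approx m k end).
  exists (fun n => F n (approx n)). intros n. apply HF. intros k Hk.
  induction Hk as [|n Hk IH].
  - simpl. now rewrite Nat.eqb_refl.
  - change (approx (S n) k) with (if Nat.eqb k n then F n (approx n) else approx n k).
    destruct (Nat.eqb_spec k n) as [E|_]; [lia|exact IH].
Qed.

(** The power series solution of [u' = p u], [u 0 = 1]; when the coefficients of
    [p] are bounded by [1], so are those of [u], because [(n + 1) u_(n + 1)] is a
    sum of [n + 1] products. *)
Lemma linear_ode (p : nat -> C) : coefs_le_1 p ->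
  exists u, u O = RtoC 1 /\ coefs_le_1 u /\ forall n, deriv_coef u n = conv p u n.
Proof.
  intros Hp.
  destruct (strong_recursion (fun n u => match n with
     | O => RtoC 1 | S m => / RtoC (INR (S m)) * conv p u m end)) as [u Hu].
  { intros [|m] u v H; [reflexivity|]. f_equal. apply Csum_ext. intros k L. f_equal.
    apply H. lia. }
  exists u. split; [apply (Hu O)|split].
  - intros n. induction n as [n IH] using lt_wf_ind. rewrite Hu. destruct n as [|m].
    + rewrite Cmod_1. lra.
    + pose proof (lt_0_INR (S m) ltac:(lia)) as P.
      rewrite Cmod_mult, <- RtoC_inv, Cmod_R, Rabs_pos_eq by
        (try apply Rgt_not_eq, P; left; now apply Rinv_0_lt_compat).
      assert (B : (Cmod (conv p u m) <= INR (S m))%R).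
      { eapply Rle_trans; [apply (Csum_Cmod _ (fun _ => 1%R))|rewrite sum_cte; lra].
        intros k L. rewrite Cmod_mult. pose proof (Cmod_ge_0 (p k)).
        pose proof (Cmod_ge_0 (u (m - k)%nat)). specialize (Hp k).
        specialize (IH (m - k)%nat ltac:(lia)). nra. }
      apply Rmult_le_reg_l with (INR (S m)); auto. rewrite <- Rmult_assoc, Rinv_r; lra.
  - intros n. unfold deriv_coef. rewrite (Hu (S n)). field.
    intros E. apply RtoC_inj in E. pose proof (lt_0_INR (S n) ltac:(lia)). lra.
Qed.

Lemma linear_ode_derive p u (z P U : C) : (Cmod z < 1)%R -> coefs_le_1 p -> coefs_le_1 u ->
  (forall n, deriv_coef u n = conv p u n) -> Cpser p z P -> Cpser u z U ->
  Cpser (deriv_coef u) z (P * U).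
Proof.
  intros Hz Hp Hu E HP HU. apply (Cser_ext (fun n => conv p u n * z ^ n)).
  - intros n. now rewrite E.
  - now apply Cpser_mult_le_1.
Qed.

Lemma Cpser_neg a (z l : C) : Cpser a z l -> Cpser (fun n => - a n) z (- l).
Proof.
  intros H. replace (- l) with (- RtoC 1 * l) by ring.
  apply (Cser_ext _ _ _) with (2 := Cser_scal (- RtoC 1) _ _ H). intros; simpl; ring.
Qed.

Lemma Cpser_const (c z : C) : Cpser (fun n => match n with O => c | _ => 0 end) z c.
Proof.
  intros e He. exists O. intros n _. rewrite (Csum_support _ 0 n); [|intros [|k] L|lia].
  - simpl. replace (c * 1 - c) with (RtoC 0) by ring. now rewrite Cmod_0.
  - lia.
  - ring.
Qed.

(** The solution for [- p] is the reciprocal of the solution for [p], the product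
    having derivative [0]. *)
Lemma linear_ode_nonzero p u (P U : C -> C) : coefs_le_1 p -> coefs_le_1 u -> u O = 1 ->
  (forall n, deriv_coef u n = conv p u n) ->
  (forall z : C, (Cmod z < 1)%R -> Cpser p z (P z)) ->
  (forall z : C, (Cmod z < 1)%R -> Cpser u z (U z)) ->
  forall z : C, (Cmod z < 1)%R -> U z <> 0.
Proof.
  intros Hp Hu U0 Eu HP HU.
  assert (Hp' : coefs_le_1 (fun n => - p n)) by (intros n; rewrite Cmod_opp; apply Hp).
  destruct (linear_ode _ Hp') as [v [V0 [Hv Ev]]].
  destruct (coefs_le_1_sum v Hv) as [V HV].
  set (e := conv u v).
  assert (D : forall z : C, (Cmod z < 1)%R -> Cpser (deriv_coef e) z 0).
  { intros z Hz. 
    pose proof (linear_ode_derive p u z (P z) (U z) Hz Hp Hu Eu (HP z Hz) (HU z Hz)) as DU.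
    pose proof (linear_ode_derive _ v z (- P z) (V z) Hz Hp' Hv Ev
                  (Cpser_neg _ _ _ (HP z Hz)) (HV z Hz)) as DV.
    assert (G := infinite_sum_geom 1 (Cmod z) (conj (Cmod_ge_0 z) Hz)).
    assert (G' := infinite_sum_linear_geom (Cmod z) (conj (Cmod_ge_0 z) Hz)).
    assert (T : forall a, coefs_le_1 a -> forall n,
       (Cmod (deriv_coef a n * z ^ n) <= INR (S n) * Cmod z ^ n)%R).
    { intros a Ha n. unfold deriv_coef. rewrite !Cmod_mult, Cmod_pow, Cmod_R.
      rewrite Rabs_pos_eq by apply pos_INR. apply Rmult_le_compat_r.
      - apply pow_le, Cmod_ge_0.
      - rewrite <- (Rmult_1_r (INR (S n))) at 2. apply Rmult_le_compat_l; [apply pos_INR|apply Ha]. }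
    pose proof (Cpser_mult _ _ _ _ _ _ _ _ _ DU (HV z Hz) (T u Hu) (Cpser_term_le v z Hv) G' G) as M1.
    pose proof (Cpser_mult _ _ _ _ _ _ _ _ _ (HU z Hz) DV (Cpser_term_le u z Hu) (T v Hv) G G') as M2.
    pose proof (Cser_plus _ _ _ _ M1 M2) as M.
    replace (P z * U z * V z + U z * (- P z * V z)) with (RtoC 0) in M by ring.
    apply (Cser_ext _ _ _) with (2 := M). intros n. simpl. unfold e.
    rewrite leibniz_coef. ring. }
  assert (Z : forall n, deriv_coef e n = 0).
  { intros n. pose proof (locally_sums_unique (deriv_coef e)
      (fun n => match n with O => 0 | _ => 0 end) (fun _ => 0)) as Q.
    rewrite Q; [destruct n; reflexivity| |].
    - exists 1%R. split; [lra|exact D].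
    - exists 1%R. split; [lra|]. intros; apply Cpser_const. }
  intros z Hz Uz.
  pose proof (Cpser_mult_le_1 u v z _ _ Hz Hu Hv (HU z Hz) (HV z Hz)) as M.
  assert (M' : Cpser e z 1).
  { apply (Cser_ext _ _ _) with (2 := Cpser_const 1 z). intros [|n].
    - unfold e, conv. simpl. rewrite U0, V0. ring.
    - specialize (Z n). unfold deriv_coef in Z. f_equal.
      replace (e (S n)) with (/ RtoC (INR (S n)) * (RtoC (INR (S n)) * e (S n))).
      + rewrite Z. ring.
      + field. intros E. apply RtoC_inj in E. pose proof (lt_0_INR (S n) ltac:(lia)). lra. }
  pose proof (Cser_unique _ _ _ M M') as E. rewrite Uz, Cmult_0_l in E.
  apply RtoC_inj in E. lra.
Qed.

(** * The extremal function *)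

(** The triangle [k + j <= N] is part of the square [k, j <= N]. *)
Lemma sum_conv_le_square (x : nat -> R) N : (forall n, (0 <= x n)%R) ->
  (sum_f_R0 (fun n => sum_f_R0 (fun k => x k * x (n - k)%nat) n) N <= sum_f_R0 x N ^ 2)%R.
Proof.
  intros Hx.
  assert (T : forall m, (sum_f_R0 (fun n => sum_f_R0 (fun k => x k * x (n - k)%nat) n) m
     = sum_f_R0 (fun k => x k * sum_f_R0 x (m - k)) m)%R).
  { induction m as [|m IH]; [reflexivity|]. rewrite !tech5, IH, Nat.sub_diag.
    rewrite <- Rplus_assoc. f_equal. rewrite <- sum_plus. apply sum_eq. intros k L.
    replace (S m - k)%nat with (S (m - k)) by lia. rewrite tech5. ring. }
  rewrite T. replace (sum_f_R0 x N ^ 2)%R with (sum_f_R0 x N * sum_f_R0 x N)%R by ring.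
  rewrite scal_sum. apply sum_Rle. intros k L. apply Rmult_le_compat_l; auto.
  apply sum_f_R0_mono; auto. lia.
Qed.

(** The coefficients of [Y], where [1 - sqrt (1 + z ^ 4) = z * Y z]. Squaring
    gives [Y = (- z ^ 3 + z * Y ^ 2) / 2], which determines them recursively; by
    the same equation a bound [1] for the sum of the moduli of the first ones is
    inherited by the next. *)
Lemma sqrt_coefs : exists y : nat -> C, y O = 0 /\
  (forall n, y (S n) = / 2 * ((match n with 2%nat => - RtoC 1 | _ => 0 end) + conv y y n)) /\
  forall N, (sum_f_R0 (fun n => Cmod (y n)) N <= 1)%R.
Proof.
  destruct (strong_recursion (fun n y => match n with O => 0 | S m =>
    / 2 * ((match m with 2%nat => - RtoC 1 | _ => 0 end) + conv y y m) end)) as [y Hy].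
  { intros [|m] u v H; [reflexivity|]. do 2 f_equal. apply Csum_ext. intros k L.
    rewrite !H by lia. reflexivity. }
  exists y. split; [apply (Hy O)|split; [intros n; apply (Hy (S n))|]].
  set (x := fun n => Cmod (y n)).
  assert (Hx : forall n, (0 <= x n)%R) by (intros; apply Cmod_ge_0).
  set (d := fun n => match n with 2%nat => 1%R | _ => 0%R end).
  assert (Hd : forall N, (sum_f_R0 d N <= 1)%R).
  { intros [|[|N]]; simpl; try lra. induction N as [|N IH]; simpl in *; lra. }
  induction N as [|N IH].
  - unfold x. simpl. rewrite (Hy O), Cmod_0. lra.
  - assert (I : forall n, (x (S n) <= / 2 * (d n + sum_f_R0 (fun k => x k * x (n - k)%nat) n))%R).
    { intros n. unfold x at 1. rewrite (Hy (S n)), Cmod_mult.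
      rewrite <- RtoC_inv, Cmod_R, Rabs_pos_eq by lra. apply Rmult_le_compat_l; [lra|].
      apply Cmod_plus_le.
      - destruct n as [|[|[|n]]]; simpl; rewrite ?Cmod_0, ?Cmod_opp, ?Cmod_1; lra.
      - apply Csum_Cmod. intros k _. rewrite Cmod_mult. unfold x. lra. }
    rewrite decomp_sum by lia. simpl pred.
    assert (J : (sum_f_R0 (fun i => x (S i)) N <=
       / 2 * (sum_f_R0 d N + sum_f_R0 (fun n => sum_f_R0 (fun k => x k * x (n - k)%nat) n) N))%R).
    { rewrite <- sum_plus, scal_sum. apply sum_Rle. intros n _. rewrite Rmult_comm. apply I. }
    pose proof (sum_conv_le_square x N Hx) as Q. specialize (Hd N).
    assert (x O = 0%R) by (unfold x; rewrite (Hy O); apply Cmod_0).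
    assert (0 <= sum_f_R0 x N)%R by (apply cond_pos_sum; auto).
    fold x in IH |- *. change (x O + sum_f_R0 (fun i => x (S i)) N <= 1)%R. nra.
Qed.

(** Two square roots with nonnegative real parts, one of them positive, have a
    nonzero sum, and the product of sum and difference is [0]. *)
Lemma principal_sqrt_unique (s v : C) : s ^ 2 = v -> (0 < Re s)%R -> principal_sqrt v = s.
Proof.
  intros E Hs. pose proof (principal_sqrt_sqr v) as E'. pose proof (principal_sqrt_Re v) as P.
  set (r := principal_sqrt v) in *. clearbody r.
  assert (N : r + s <> 0).
  { intros Z. apply (f_equal Re) in Z. unfold Re in *. simpl in Z. lra. }
  replace r with (s + (r ^ 2 - s ^ 2) / (r + s)) by (field; auto).
  rewrite E, E'. field. auto.
Qed.

Lemma Cpser_monomial2 (z : C) :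
  Cpser (fun n => match n with 2%nat => 1 | _ => 0 end) z (z ^ 2).
Proof.
  intros e He. exists 2%nat. intros n Hn. rewrite (Csum_support _ 2 n); [|intros k L|lia].
  - simpl. replace (0 * 1 + 0 * (z * 1) + 1 * (z * (z * 1)) - z * (z * 1)) with (RtoC 0) by ring.
    now rewrite Cmod_0.
  - destruct k as [|[|[|k]]]; try lia. ring.
Qed.

Lemma square_analytic : analytic_in_disk (fun z => z ^ 2).
Proof.
  apply (coefs_le_1_analytic (fun n => match n with 2%nat => 1 | _ => 0 end)).
  - intros [|[|[|n]]]; rewrite ?Cmod_0, ?Cmod_1; lra.
  - intros z _. apply Cpser_monomial2.
Qed.

(** With [Y] as in [sqrt_coefs], [P z = z - Y z]: as [|z * Y z| < 1], the root
    [1 - z * Y z] of [1 + z ^ 4] is the principal one. The coefficient of [z] in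
    [Y] vanishes, so that all coefficients of [P] are bounded by [1]. *)
Lemma extremal_log_derivative : exists (p : nat -> C) (P : C -> C),
  coefs_le_1 p /\ p 0%nat = 0 /\ p 1%nat = 1 /\
  forall z : C, (Cmod z < 1)%R -> Cpser p z (P z) /\ q (z ^ 2) = 1 + z * P z.
Proof.
  destruct sqrt_coefs as [y [Y0 [YS YB]]].
  assert (Hy : coefs_le_1 y).
  { intros n. eapply Rle_trans; [|apply (YB n)].
    apply (term_le_sum (fun n => Cmod (y n))); auto. intros; apply Cmod_ge_0. }
  destruct (coefs_le_1_sum y Hy) as [Y HY].
  assert (Y1 : y 1%nat = 0) by (rewrite YS; unfold conv; simpl; rewrite Y0; ring).
  exists (fun n => match n with 1%nat => 1 | _ => - y n end), (fun z => z - Y z).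
  split; [|split; [|split]].
  - intros [|[|n]]; rewrite ?Cmod_opp, ?Cmod_1; try apply Hy; lra.
  - rewrite Y0. ring.
  - reflexivity.
  - intros z Hz. split.
    + apply Cser_shift. simpl. rewrite Y0.
      replace (z - Y z - - 0 * 1) with (z + - (Y z - y 0%nat * z ^ 0)) by (rewrite Y0; ring).
      pose proof (proj1 (Cser_shift _ _) (HY z Hz)) as S1.
      apply (Cser_ext (fun n => z * ((match n with O => 1 | _ => 0 end) * z ^ n)
               + - RtoC 1 * (y (S n) * z ^ S n))).
      { intros [|n]; [rewrite Y1|]; simpl; ring. }
      apply Cser_plus.
      * pose proof (Cser_scal z _ _ (Cpser_const 1 z)) as C1. rewrite Cmult_1_r in C1. exact C1.
      * replace (- (Y z - y 0%nat * z ^ 0)) with (- RtoC 1 * (Y z - y 0%nat * z ^ 0)) by ring.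
        now apply (Cser_scal (- RtoC 1)).
    + assert (Q : Y z = / 2 * (z * (Y z * Y z) - z ^ 3)).
      { pose proof (proj1 (Cser_shift _ _) (HY z Hz)) as S1.
        cbv beta in S1. rewrite Y0, Cmult_0_l in S1. replace (Y z - 0) with (Y z) in S1 by ring.
        apply (Cser_unique _ _ _ S1).
        pose proof (Cpser_mult_le_1 y y z _ _ Hz Hy Hy (HY z Hz) (HY z Hz)) as M.
        replace (/ 2 * (z * (Y z * Y z) - z ^ 3))
          with (/ 2 * z * (Y z * Y z) + - (/ 2 * z) * z ^ 2) by ring.
        apply (Cser_ext (fun n => / 2 * z * (conv y y n * z ^ n)
                 + - (/ 2 * z) * ((match n with 2%nat => 1 | _ => 0 end) * z ^ n))).
        { intros n. rewrite YS. destruct n as [|[|[|n]]]; simpl; ring. }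
        apply Cser_plus; [apply Cser_scal, M|apply Cser_scal, Cpser_monomial2]. }
      assert (B : (Cmod (Y z) <= 1)%R).
      { apply (Cser_le (fun n => y n * z ^ n)); [|apply HY, Hz]. intros n.
        eapply Rle_trans; [apply (Csum_Cmod _ (fun n => Cmod (y n)))|apply YB].
        intros k _. rewrite Cmod_mult, Cmod_pow.
        rewrite <- (Rmult_1_r (Cmod (y k))) at 2. apply Rmult_le_compat_l; [apply Cmod_ge_0|].
        rewrite <- (pow1 k). apply pow_incr. split; [apply Cmod_ge_0|lra]. }
      unfold q. rewrite (principal_sqrt_unique (1 - z * Y z)); [ring| |].
      * replace ((1 - z * Y z) ^ 2) with (1 - 2 * z * Y z + z ^ 2 * (Y z * Y z)) by ring.
        rewrite Q at 1. field.
      * pose proof (re_le_Cmod (z * Y z)) as R1. apply Rabs_le_between in R1.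
        rewrite Cmod_mult in R1. pose proof (Cmod_ge_0 (Y z)). pose proof (Cmod_ge_0 z).
        assert (R2 : Re (1 - z * Y z) = (1 - Re (z * Y z))%R) by reflexivity.
        rewrite R2. nra.
Qed.

(** [f z = z * U z] with [U' = P * U] satisfies
    [z * f' z / f z = 1 + z * P z = q (z ^ 2)], that is, [w z = z ^ 2]. *)
Lemma extremal_function : exists (f : C -> C) (a : nat -> C),
  class_S_star q f /\ has_expansion f 0 a /\ Cmod (hankel_2_2 a) = (1 / 4)%R.
Proof.
  destruct extremal_log_derivative as [p [P [Hp [P0 [P1 HP]]]]].
  destruct (linear_ode p Hp) as [u [U0 [Hu Eu]]].
  destruct (coefs_le_1_sum u Hu) as [U HU].
  assert (NU := linear_ode_nonzero p u P U Hp Hu U0 Eu (fun z Hz => proj1 (HP z Hz)) HU).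
  set (a := fun n => match n with O => RtoC 0 | S m => u m end).
  set (f := fun z => z * U z).
  assert (Ha : coefs_le_1 a).
  { intros [|n]; simpl; [rewrite Cmod_0; lra|apply Hu]. }
  assert (Hf : forall z : C, (Cmod z < 1)%R -> Cpser a z (f z)).
  { intros z Hz. apply Cser_shift. simpl. replace (f z - 0 * 1) with (z * U z) by (unfold f; ring).
    apply (Cser_ext _ _ _) with (2 := Cser_scal z _ _ (HU z Hz)). intros; simpl; ring. }
  destruct (coefs_le_1_analytic a f Ha Hf) as [Fan Fder].
  assert (D : forall z : C, (Cmod z < 1)%R -> C_derive f z = U z * q (z ^ 2)).
  { intros z Hz. apply (Cser_unique _ _ _ (Fder z Hz)). destruct (HP z Hz) as [HPz ->].
    replace (U z * (1 + z * P z)) with (U z + z * (P z * U z)) by ring.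
    pose proof (linear_ode_derive p u z _ _ Hz Hp Hu Eu HPz (HU z Hz)) as DU.
    apply (Cser_ext (fun n => u n * z ^ n + RtoC (INR n) * (u n * z ^ n))).
    - intros n. unfold deriv_coef. rewrite S_INR, RtoC_plus. simpl. ring.
    - apply Cser_plus; [apply HU, Hz|]. apply Cser_shift. simpl (INR 0).
      replace (z * (P z * U z) - 0 * (u 0%nat * z ^ 0)) with (z * (P z * U z)) by ring.
      apply (Cser_ext _ _ _) with (2 := Cser_scal z _ _ DU). intros n.
      unfold deriv_coef. simpl. ring. }
  assert (Z : (Cmod 0 < 1)%R) by (rewrite Cmod_0; lra).
  assert (Q0 : q (0 ^ 2) = 1).
  { rewrite (proj2 (HP 0 Z)). ring. }
  assert (EU0 : U 0 = 1) by (rewrite (Cpser_0 _ _ (HU 0 Z)); exact U0).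
  exists f, a. split; [split; [|split]|split].
  - split; [exact Fan|split]; [unfold f; ring|]. rewrite D, Q0, EU0 by exact Z. ring.
  - intros z Hz z0 E. unfold f in E. apply (NU z Hz).
    replace (U z) with (/ z * (z * U z)) by (field; auto). rewrite E. ring.
  - exists (fun z => z ^ 2). split; [exact square_analytic|split; [ring|split]].
    + intros z Hz. unfold unit_disk in *. rewrite Cmod_pow. pose proof (Cmod_ge_0 z). nra.
    + intros z Hz. unfold zf'_over_f. destruct (Ceq_dec z 0) as [->|z0]; [now rewrite Q0|].
      rewrite (D z Hz). unfold f. field. split; auto.
  - apply has_expansion_locally_sums. exists 1%R. split; [lra|]. intros z Hz.
    replace (0 + z) with z by ring. auto.
  - pose proof (Eu 0%nat) as E1. pose proof (Eu 1%nat) as E2.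
    unfold deriv_coef, conv in E1, E2. simpl in E1, E2. rewrite P0, P1, U0 in *.
    assert (A2 : u 1%nat = 0) by (replace (u 1%nat) with (1 * u 1%nat) by ring; rewrite E1; ring).
    assert (A3 : u 2%nat = RtoC (/ 2)).
    { rewrite RtoC_plus in E2. rewrite RtoC_inv by lra.
      replace (u 2%nat) with (/ 2 * ((1 + 1) * u 2%nat)) by field. rewrite E2. ring. }
    unfold hankel_2_2, a. rewrite A2, A3.
    replace (0 * u 3%nat - RtoC (/ 2) ^ 2) with (- RtoC (/ 4)).
    + rewrite Cmod_opp, Cmod_R, Rabs_pos_eq; lra.
    + rewrite !RtoC_inv by lra. field.
Qed.

Theorem theorem4 :
  (forall (f : C -> C) (a : nat -> C),
     class_S_star q f -> has_expansion f (RtoC 0) a ->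
     (Cmod (hankel_2_2 a) <= 1 / 4)%R)
  /\
  (forall M : R,
     (forall (f : C -> C) (a : nat -> C),
        class_S_star q f -> has_expansion f (RtoC 0) a ->
        (Cmod (hankel_2_2 a) <= M)%R) ->
     (1 / 4 <= M)%R).
Proof.
  split.
  - exact hankel_bound.
  - intros M H. destruct extremal_function as [f [a [Hf [Ha E]]]].
    rewrite <- E. exact (H f a Hf Ha).
Qed.
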